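(* Let $m$ and $n$ be positive integers and put $\kappa:=m+n$. For $r\ge1$ let $(m^r)$ denote the partition with $r$ parts all equal to $m$. Then, as formal power series in $q$ (coefficientwise limit), \[ \lim_{r\to\infty} q^{-m\binom{r}{2}} P_{(m^r)}\big(1,q,q^2,\dots;q^n\big) =\frac{(q^{\kappa};q^{\kappa})_{\infty}^{n-1}}{(q;q)_{\infty}^n}\prod_{1\leq i<j\leq n}\theta\big(q^{j-i};q^{\kappa}\big) =\frac{(q^{\kappa};q^{\kappa})_{\infty}^{m-1}}{(q;q)_{\infty}^m}\prod_{1\leq i<j\leq m}\theta\big(q^{j-i};q^{\kappa}\big). \]
   Context: For $k\ge0$, $(a;q)_k=\prod_{j=0}^{k-1}(1-aq^j)$ and $(a;q)_\infty=\prod_{j\ge0}(1-aq^j)$; $\theta(a;q):=(a;q)_\infty(q/a;q)_\infty$. Hall–Littlewood polynomials: for variables $x=(x_1,\dots,x_N)$, a parameter $t$ and a partition $\lambda$ with at most $N$ nonzero parts, let $m_i$ be the number of parts of $\lambda$ equal to $i$ ($m_0:=N-$ number of nonzero parts), $v_\lambda(t)=\prod_{i\ge0}(t;t)_{m_i}/(1-t)^{m_i}$, and $P_\lambda(x;t)=\frac{1}{v_\lambda(t)}\sum_{w\in\mathfrak S_N} w\Big(x_1^{\lambda_1}\cdots x_N^{\lambda_N}\prod_{i<j}\frac{x_i-tx_j}{x_i-x_j}\Big)$, where $\mathfrak S_N$ permutes the variables; $P_\lambda:=0$ if $\lambda$ has more than $N$ nonzero parts. These define Hall–Littlewood symmetric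 functions in infinitely many variables; $P_\lambda(1,q,q^2,\dots;t)$ denotes the specialization $x_i=q^{i-1}$ ($i\ge1$), i.e. the $N\to\infty$ limit of $P_\lambda(1,q,\dots,q^{N-1};t)$ as a formal power series in $q$. Here $t=q^n$. *)

(* Defs.v *)
From HB Require Import structures.
From mathcomp Require Import all_boot all_order all_fingroup all_algebra.
From mathcomp Require Import zify ring boolp classical_sets.

Set Implicit Arguments.
Unset Strict Implicit.
Unset Printing Implicit Defensive.

Import GRing.Theory.
Local Open Scope ring_scope.

Reserved Notation "{ 'fps' R }" (at level 0, format "{ 'fps'  R }").

(* Formal power series: the k-th coefficient of [a] is written [a k]. *)

Record fps (R : Type) := Fps { fps_coef :> nat -> R }.

Notation "{ 'fps' R }" := (fps R) : type_scope.

Lemma fpsP (R : Type) (a b : {fps R}) : (forall k, a k = b k) -> a = b.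
Proof. by case: a b => a [b] /= eq_ab; congr Fps; apply: funext. Qed.

HB.instance Definition _ (R : Type) := gen_eqMixin {fps R}.
HB.instance Definition _ (R : Type) := gen_choiceMixin {fps R}.

Section FpsRing.
Variable R : comNzRingType.
Implicit Types a b c : {fps R}.

Definition fps_zero : {fps R} := Fps (fun=> 0).
Definition fps_opp a : {fps R} := Fps (fun k => - a k).
Definition fps_add a b : {fps R} := Fps (fun k => a k + b k).

Fact fps_addA : associative fps_add.
Proof. by move=> a b c; apply: fpsP => k /=; rewrite addrA. Qed.
Fact fps_addC : commutative fps_add.
Proof. by move=> a b; apply: fpsP => k /=; rewrite addrC. Qed.
Fact fps_add0 : left_id fps_zero fps_add.
Proof. by move=> a; apply: fpsP => k /=; rewrite add0r. Qed.
Fact fps_addN : left_inverse fps_zero fps_opp fps_add.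
Proof. by move=> a; apply: fpsP => k /=; rewrite addNr. Qed.

HB.instance Definition _ :=
  GRing.isZmodule.Build {fps R} fps_addA fps_addC fps_add0 fps_addN.

Definition fpsC (x : R) : {fps R} := Fps (fun k => if k is 0%N then x else 0).
Definition fps_mul a b : {fps R} :=
  Fps (fun k => \sum_(i < k.+1) a i * b (k - i)%N).

Let trunc n a : {poly R} := \poly_(i < n) a i.

Let mul_trunc n a b k : (k < n)%N -> fps_mul a b k = (trunc n a * trunc n b)`_k.
Proof.
move=> lt_kn; rewrite coefM /=; apply: eq_bigr => i _.
by rewrite !coef_poly !(leq_ltn_trans _ lt_kn) ?leq_subr // -ltnS.
Qed.

Fact fps_mulC : commutative fps_mul.
Proof.
by move=> a b; apply: fpsP => k; rewrite !(mul_trunc _ _ (ltnSn k)) mulrC.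
Qed.

Fact fps_mulA : associative fps_mul.
Proof.
move=> a b c; apply: fpsP => k; set n := k.+1.
have E (p q : {poly R}) (r : {poly R}) :
    (forall i, (i < n)%N -> p`_i = q`_i) -> (p * r)`_k = (q * r)`_k.
  move=> Epq; rewrite !coefM; apply: eq_bigr => i _.
  by rewrite Epq // ltn_ord.
have T (u v : {fps R}) i : (i < n)%N ->
    (trunc n (fps_mul u v))`_i = (trunc n u * trunc n v)`_i.
  by move=> lt_in; rewrite coef_poly lt_in (mul_trunc _ _ lt_in).
rewrite !(mul_trunc _ _ (ltnSn k)) -/n [trunc n a * _]mulrC.
rewrite (E _ _ _ (T b c)) [_ * trunc n a]mulrC mulrA.
by rewrite (E _ _ _ (T a b)).
Qed.

Fact fps_mul1 : left_id (fpsC 1) fps_mul.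
Proof.
move=> a; apply: fpsP => k /=; rewrite big_ord_recl /= mul1r subn0.
by rewrite big1 ?addr0 // => i _; rewrite mul0r.
Qed.

Fact fps_mulDl : left_distributive fps_mul fps_add.
Proof.
move=> a b c; apply: fpsP => k /=; rewrite -big_split /=.
by apply: eq_bigr => i _; rewrite mulrDl.
Qed.

Fact fps_oneN0 : fpsC 1 != 0 :> {fps R}.
Proof.
by apply/eqP => /(congr1 (fun a : {fps R} => a 0%N)) /eqP; rewrite oner_eq0.
Qed.

HB.instance Definition _ := GRing.Zmodule_isComNzRing.Build {fps R}
  fps_mulA fps_mulC fps_mul1 fps_mulDl fps_oneN0.

Definition fpsX : {fps R} := Fps (fun k => (k == 1)%:R).

Lemma coef_fps0 k : (0 : {fps R}) k = 0. Proof. by []. Qed.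
Lemma coef_fps1 k : (1 : {fps R}) k = (k == 0)%:R. Proof. by case: k. Qed.
Lemma coef_fpsD a b k : (a + b) k = a k + b k. Proof. by []. Qed.
Lemma coef_fpsN a k : (- a) k = - a k. Proof. by []. Qed.
Lemma coef_fpsB a b k : (a - b) k = a k - b k. Proof. by []. Qed.
Lemma coef_fpsM a b k : (a * b) k = \sum_(i < k.+1) a i * b (k - i)%N.
Proof. by []. Qed.

Lemma coef_fps_sum I (r : seq I) (P : pred I) (F : I -> {fps R}) k :
  (\sum_(i <- r | P i) F i) k = \sum_(i <- r | P i) F i k.
Proof. exact: (big_morph (fun a : {fps R} => a k)). Qed.

Lemma coef_fpsCM x a k : (fpsC x * a) k = x * a k.
Proof.
rewrite coef_fpsM big_ord_recl /= subn0 big1 ?addr0 // => i _.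
by rewrite mul0r.
Qed.

Lemma coef_fpsXM a k : (fpsX * a) k = if k is k'.+1 then a k' else 0.
Proof.
rewrite coef_fpsM; case: k => [|k]; first by rewrite big_ord1 /= mul0r.
rewrite 2!big_ord_recl /= mul0r mul1r add0r subn1 /= big1 ?addr0 // => i _.
by rewrite mul0r.
Qed.

Lemma coef_fpsXn n k : (fpsX ^+ n) k = (k == n)%:R.
Proof.
elim: n k => [|n IHn] [|k]; rewrite ?expr0 ?coef_fps1 //.
  by rewrite exprS coef_fpsXM.
by rewrite exprS coef_fpsXM IHn.
Qed.

Lemma coef_fps_expr_lt a n k : a 0%N = 0 -> (k < n)%N -> (a ^+ n) k = 0.
Proof.
move=> a0; elim: n k => // n IHn k; rewrite ltnS => le_kn.
rewrite exprS coef_fpsM big1 // => -[[|i] lt_i] _ /=; first by rewrite a0 mul0r.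
by rewrite IHn ?mulr0 //; lia.
Qed.

End FpsRing.

Section FpsUnit.
Variable R : comUnitRingType.
Implicit Types a b : {fps R}.

Definition fps_unit : {pred {fps R}} := fun a => a 0%N \is a GRing.unit.

(* For an invertible constant term x, the coefficient of degree k of the      *)
(* inverse is read off the geometric series x^-1 * \sum_j (1 - x^-1 a)^j,     *)
(* whose terms of index j > k have no coefficient of degree k.                *)
Definition fps_inv a : {fps R} :=
  if fps_unit a then
    Fps (fun k => (a 0)^-1 * (\sum_(j < k.+1) (1 - fpsC (a 0)^-1 * a) ^+ j) k)
  else a.

Fact fps_mulV : {in fps_unit, left_inverse 1 fps_inv *%R}.
Proof.
move=> a Ua; rewrite /fps_inv [fps_unit a]Ua.
set x := (a 0%N)^-1; set u := 1 - _.
have u0 : u 0%N = 0.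
  by rewrite coef_fpsB coef_fps1 coef_fpsCM /x mulVr ?subrr.
apply: fpsP => k.
pose s := \sum_(j < k.+1) u ^+ j.
have sE i : (i <= k)%N -> (\sum_(j < i.+1) u ^+ j) i = s i.
  move=> le_ik; rewrite /s !coef_fps_sum -!(big_mkord xpredT (fun j => (u ^+ j) i)).
  rewrite [RHS](@big_cat_nat _ _ _ i.+1) //= [X in _ + X]big_nat_cond.
  rewrite [X in _ + X]big1 ?addr0 // => j; rewrite andbT => /andP[lt_ij _].
  exact: coef_fps_expr_lt.
transitivity ((fpsC x * s * a) k).
  rewrite !coef_fpsM; apply: eq_bigr => i _; congr (_ * _).
  by rewrite coef_fpsCM /= sE // -ltnS.
have -> : fpsC x * s * a = s * (1 - u) by rewrite /u subKr; ring.
have -> : s * (1 - u) = 1 - u ^+ k.+1.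
  by rewrite -[1 in RHS](expr1n _ k.+1) subrXX mulrC; congr (_ * _);
     apply: eq_bigr => i _; rewrite expr1n mul1r.
by rewrite coef_fpsB coef_fps_expr_lt ?subr0.
Qed.

Fact fps_unitPl a b : b * a = 1 -> fps_unit a.
Proof.
move=> /(congr1 (fun c : {fps R} => c 0%N)); rewrite coef_fpsM big_ord1 /=.
by move=> ba1; apply/unitrPr; exists (b 0%N); rewrite mulrC.
Qed.

Fact fps_inv_out : {in [predC fps_unit], fps_inv =1 id}.
Proof. by move=> a /negPf Ua; rewrite /fps_inv; move: Ua; rewrite /in_mem /= => ->. Qed.

HB.instance Definition _ := GRing.ComNzRing_hasMulInverse.Build {fps R}
  fps_mulV fps_unitPl fps_inv_out.

Lemma fps_unitE a : (a \is a GRing.unit) = (a 0%N \is a GRing.unit).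
Proof. by []. Qed.

End FpsUnit.

Section FpsIntegral.
Variable R : idomainType.

Fact fps_integral : GRing.integral_domain_axiom {fps R}.
Proof.
move=> a b ab0; apply/norP => -[a0 b0].
have lead (c : {fps R}) : c != 0 ->
    exists2 i, c i != 0 & forall j, (j < i)%N -> c j = 0.
  move=> c0; have exc : exists i, c i != 0.
    apply: contrapT => nc; move/eqP: c0; apply; apply: fpsP => i.
    by apply/eqP/negPn/negP => ci; apply: nc; exists i.
  case: (ex_minnP exc) => i ci imin; exists i => // j; apply: contraTeq.
  by rewrite -leqNgt; apply: imin.
have [i ai mini] := lead a a0; have [j bj minj] := lead b b0.
have : (a * b) (i + j)%N = 0 by rewrite ab0.
have lt_i : (i < (i + j).+1)%N by rewrite ltnS leq_addr.
rewrite coef_fpsM (bigD1 (Ordinal lt_i)) //= addKn big1 ?addr0 => [/eqP|k].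
  by rewrite mulf_eq0 (negPf ai) (negPf bj).
rewrite -val_eqE /= neq_ltn => /orP[lt_ki|lt_ik].
  by rewrite mini ?mul0r.
by rewrite minj ?mulr0 //; have := ltn_ord k; lia.
Qed.

HB.instance Definition _ :=
  GRing.ComUnitRing_isIntegral.Build {fps R} fps_integral.

End FpsIntegral.

(* The ring of coefficients is discrete: each coefficient of u is eventually  *)
(* constant.  fps_lim u is meaningless if u does not converge.                *)

Definition fps_cvg (R : Type) (u : nat -> {fps R}) (a : {fps R}) : Prop :=
  forall k, exists N0, forall N, (N0 <= N)%N -> u N k = a k.

Definition fps_lim (R : comNzRingType) (u : nat -> {fps R}) : {fps R} :=
  xget 0 (fps_cvg u).

Lemma fps_cvg_unique (R : Type) (u : nat -> {fps R}) a b :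
  fps_cvg u a -> fps_cvg u b -> a = b.
Proof.
move=> ua ub; apply: fpsP => k; have [M ukM] := ua k; have [N ukN] := ub k.
by rewrite -(ukM (maxn M N)) ?leq_maxl // -(ukN (maxn M N)) ?leq_maxr.
Qed.

Lemma fps_limE (R : comNzRingType) (u : nat -> {fps R}) a :
  fps_cvg u a -> fps_lim u = a.
Proof.
by move=> ua; apply: xget_unique => // b ub; exact: fps_cvg_unique ub ua.
Qed.

(* qpoch a p k is (a;p)_k, with base p. *)

Definition qpoch (R : comNzRingType) (a p : R) (k : nat) : R :=
  \prod_(0 <= j < k) (1 - a * p ^+ j).

Definition qpoch_inf (R : comNzRingType) (a p : {fps R}) : {fps R} :=
  fps_lim (qpoch a p).

Lemma qpoch_inf_cvg (R : comNzRingType) (a p : {fps R}) :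
  p 0%N = 0 -> fps_cvg (qpoch a p) (qpoch_inf a p).
Proof.
move=> p0; pose l : {fps R} := Fps (fun k => qpoch a p k.+1 k).
suff cl : fps_cvg (qpoch a p) l by rewrite /qpoch_inf (fps_limE cl).
move=> k; exists k.+1 => N /subnK<-; elim: (N - k.+1)%N => // d IHd.
have -> : qpoch a p (d.+1 + k.+1)%N =
    qpoch a p (d + k.+1)%N - qpoch a p (d + k.+1)%N * a * p ^+ (d + k.+1)%N.
  by rewrite {1}/qpoch addSn big_nat_recr //= -/(qpoch a p _); ring.
rewrite coef_fpsB IHd coef_fpsM big1 ?subr0 // => i _.
by rewrite (coef_fps_expr_lt p0) ?mulr0 //; lia.
Qed.

(* theta(a;p) = (a;p)_oo (p/a;p)_oo.  As p/a must be a power series for the   *)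
(* second factor to make sense, it is the exact quotient of p by a in {fps R} *)
(* (which is meaningless if a does not divide p).                             *)

Definition fps_quo (R : idomainType) (a b : {fps R}) : {fps R} :=
  xget 0 [set c | c * b = a]%classic.

Lemma fps_quoP (R : idomainType) (b c : {fps R}) :
  b != 0 -> fps_quo (c * b) b = c.
Proof.
by move=> b0; apply: xget_unique => //= d /(mulIf b0).
Qed.

Definition theta (R : idomainType) (a p : {fps R}) : {fps R} :=
  qpoch_inf a p * qpoch_inf (fps_quo p a) p.

Lemma fpsXn_neq0 (R : comNzRingType) n : fpsX R ^+ n != 0.
Proof.
apply/eqP => /(congr1 (fun a : {fps R} => a n)) /eqP.
by rewrite coef_fpsXn eqxx oner_eq0.
Qed.

Lemma theta_XnXn (R : idomainType) (d k : nat) : (d <= k)%N ->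
  theta (fpsX R ^+ d) (fpsX R ^+ k) =
  qpoch_inf (fpsX R ^+ d) (fpsX R ^+ k) *
  qpoch_inf (fpsX R ^+ (k - d)) (fpsX R ^+ k).
Proof.
move=> le_dk; rewrite /theta.
by rewrite -{2}(subnK le_dk) exprD fps_quoP ?fpsXn_neq0.
Qed.

(* Hall-Littlewood polynomials.  A partition is a nonincreasing sequence of   *)
(* natural numbers, possibly with trailing zeros, and [x] is a tuple of N     *)
(* elements of a field.  [hall_littlewood x t lam] is the value at [x] and    *)
(* [t] of the defining formula of P_lam(x;t); it is the value of the          *)
(* polynomial as soon as the x_i are pairwise distinct and hl_v N lam t != 0, *)
(* which holds below (see fracX_expr_inj and hl_v_neq0).                      *)

Section HallLittlewood.
Variables (F : fieldType) (N : nat).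
Implicit Types (x : 'I_N -> F) (t : F) (lam : seq nat).

Definition nonzero_parts lam : nat := count (predC1 0%N) lam.

Definition part_mult lam (i : nat) : nat :=
  if i is 0 then (N - nonzero_parts lam)%N else count_mem i lam.

(* The multiplicities of the i greater than the largest part are 0. *)
Definition hl_v lam t : F :=
  \prod_(0 <= i < (\max_(k <- lam) k).+1)
     (qpoch t t (part_mult lam i) / (1 - t) ^+ part_mult lam i).

Definition hall_littlewood x t lam : F :=
  if (nonzero_parts lam <= N)%N then
    (hl_v lam t)^-1 *
    \sum_(w : 'S_N)
       (\prod_(i < N) x (w i) ^+ nth 0%N lam i) *
       (\prod_(i < N) \prod_(j < N | (i < j)%N)
          ((x (w i) - t * x (w j)) / (x (w i) - x (w j))))
  else 0.

End HallLittlewood.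

(* The formal Laurent series in lq, as the fraction field of {fps rat}.       *)

Notation "x %:F" := (tofrac x) : ring_scope.
Notation laurent := {fraction {fps rat}}.

Definition lq : laurent := (fpsX rat)%:F.

(* The Laurent series u N are all formal power series, and they converge      *)
(* coefficientwise to the power series a.                                     *)
Definition laurent_cvg (u : nat -> laurent) (a : {fps rat}) : Prop :=
  exists2 v : nat -> {fps rat}, (forall N, (v N)%:F = u N) & fps_cvg v a.

Lemma laurent_cvg_unique (u : nat -> laurent) a b :
  laurent_cvg u a -> laurent_cvg u b -> a = b.
Proof.
move=> [v vu va] [w wu wb]; apply: (fps_cvg_unique va).
suff -> : v = w by [].
by apply: funext => N; apply/eqP; rewrite -tofrac_eq vu wu.
Qed.

Lemma fracX_expr_inj : injective (fun i => lq ^+ i).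
Proof.
move=> i j; rewrite /lq -!tofracXn => /eqP; rewrite tofrac_eq => /eqP.
move=> /(congr1 (fun a : {fps rat} => a i)) /eqP; rewrite !coef_fpsXn eqxx.
by case: (eqVneq i j) => // _; rewrite oner_eq0.
Qed.

Lemma hl_v_neq0 N lam n : (0 < n)%N -> hl_v N lam (lq ^+ n) != 0.
Proof.
move=> n0; have nz k : (0 < k)%N -> 1 - lq ^+ k != 0.
  rewrite subr_eq0 -(expr0 lq) (inj_eq fracX_expr_inj) eq_sym.
  by case: k.
rewrite /hl_v prodf_seq_neq0; apply/allP => i _ /=.
rewrite mulf_neq0 ?invr_eq0 ?expf_neq0 ?nz //.
rewrite /qpoch prodf_seq_neq0; apply/allP => j _ /=.
by rewrite -exprM -exprD nz // addn_gt0 n0.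
Qed.

(* P is the formal power series P_lam(1,q,q^2,...;q^n), i.e. the limit of     *)
(* P_lam(1,q,...,q^(N-1);q^n); it is unique by laurent_cvg_unique.            *)
Definition hl_principal (n : nat) (lam : seq nat) (P : {fps rat}) : Prop :=
  laurent_cvg
    (fun N => hall_littlewood (fun i : 'I_N => lq ^+ i) (lq ^+ n) lam) P.

(* (q^k;q^k)_oo^(n-1) / (q;q)_oo^n * prod_(1 <= i < j <= n) theta(q^(j-i);q^k) *)
Definition theta_side (k n : nat) : {fps rat} :=
  let q := fpsX rat in
  qpoch_inf (q ^+ k) (q ^+ k) ^+ n.-1 / qpoch_inf q q ^+ n *
  \prod_(1 <= j < n.+1) \prod_(1 <= i < j) theta (q ^+ (j - i)) (q ^+ k).

(* Hence the division in theta_side is not by a non-unit. *)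
Lemma qpoch_inf_unit n : qpoch_inf (fpsX rat) (fpsX rat) ^+ n \is a GRing.unit.
Proof.
rewrite unitrX // fps_unitE.
have /qpoch_inf_cvg : fpsX rat 0%N = 0 by [].
move=> /(_ (fpsX rat) 0%N) [M /(_ M (leqnn M)) <-].
rewrite /qpoch; elim: M => [|M IHM]; first by rewrite big_geq.
rewrite big_nat_recr // coef_fpsM big_ord1 unitrM IHM.
by rewrite coef_fpsB coef_fpsXM subr0.
Qed.

(* Main.v *)
Require Import Defs.
From mathcomp Require Import all_boot all_order all_fingroup all_algebra.
From mathcomp Require Import zify ring boolp.

Set Implicit Arguments.
Unset Strict Implicit.
Unset Printing Implicit Defensive.

Import GRing.Theory.
Local Open Scope ring_scope.

(* Write t = q^n.  Grouping the permutations by the images of the first r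
   positions, P_(m^r)(1,...,q^(N-1);t) is the sum over the r-subsets I of
   {0,...,N-1} of prod_(i in I) q^(m i) prod_(i in I, j notin I)
   (q^i - t q^j) / (q^i - q^j).  A term vanishes unless I meets every residue
   class a mod n in an initial segment, of size k_a say; as N tends to infinity,
   the terms tend to products of the factors 1 / (1 - q^(y_b - i)) with
   y_b = b + n k_b.  A Vandermonde identity rewrites such a term as a
   Vandermonde determinant in the q^(y_b) divided by the product of all
   (q^(c+n-a);q^n)_(k_c).

   The same analysis applies without the weight q^(m i) to the points
   q^(a + kappa s), 0 <= a < n, with t = q^kappa; there the sum over subsets is
   a q-binomial coefficient, which tends to 1 / (q^kappa;q^kappa)_r (this is
   Milne's proof of the Macdonald identity for A_(n-1)).  Expanding the
   Vandermonde determinants over w and replacing (w, k) by (w^-1, k o w^-1)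
   identifies the numerators of the two sums for every r.  Hence the ratio of
   the limits is the ratio of the infinite denominators, which is the theta
   quotient.  Error terms are controlled by their order in q: either every y_b
   is large, or some y_b is small and then many factors with i > y_b raise the
   order of the term. *)

(** * Sums over subsets *)

Lemma big_offdiag (R : Type) (idx : R) (op : Monoid.com_law idx) (N : nat)
    (f : 'I_N -> 'I_N -> R) :
  \big[op/idx]_(i < N) \big[op/idx]_(j < N | j != i) f i j =
  \big[op/idx]_(i < N) \big[op/idx]_(j < N | (i < j)%N) op (f i j) (f j i).
Proof.
transitivity (\big[op/idx]_(i < N) op (\big[op/idx]_(j < N | (i < j)%N) f i j)
                       (\big[op/idx]_(j < N | (j < i)%N) f i j)).
  apply: eq_bigr => i _; rewrite (bigID (fun j : 'I_N => (i < j)%N)) /=.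
  by congr (op _ _); apply: eq_bigl => j; rewrite -val_eqE /=; lia.
rewrite big_split /= [X in op _ X](exchange_big_dep xpredT) //= -big_split /=.
by apply: eq_bigr => i _; rewrite -big_split.
Qed.

Lemma prod_diag_pairs (R : comPzSemiRingType) (n : nat) (h : 'I_n -> 'I_n -> R) :
  \prod_(a < n) \prod_(b < n) h a b =
  (\prod_(a < n) h a a) * \prod_(a < n) \prod_(b < n | (a < b)%N) (h a b * h b a).
Proof. by rewrite -big_offdiag -big_split; apply: eq_bigr => a _; rewrite (bigD1 a). Qed.

(** Each new position satisfying [P] is paired with the earlier ones, which is Pascal's rule for
    binomials over 2. *)
Lemma sum_pairs_pred (P : pred nat) (N : nat) :
  (\sum_(0 <= j < N) P j * \sum_(0 <= i < j) P i = 'C(\sum_(0 <= i < N) P i, 2))%N.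
Proof.
elim: N => [|N IHN]; first by rewrite !big_geq.
rewrite !big_nat_recr //= IHN; case: (P N); last by rewrite mul0n !addn0.
by rewrite mul1n addn1 binS bin1.
Qed.

Lemma prod_pairs_set (R : comPzSemiRingType) (N : nat) (A : {set 'I_N}) (t : R) :
  \prod_(i < N) \prod_(j < N | (i < j)%N)
     (if (i \in A) && (j \in A) then t else 1) = t ^+ 'C(#|A|, 2).
Proof.
(* Membership in [A] becomes a predicate on natural numbers, so that the pair count [sum_pairs_pred]
   applies. *)
pose P s := [exists i : 'I_N, (val i == s) && (i \in A)].
have PE i : P (val i) = (i \in A).
  by apply/existsP/idP => [[j /andP[/eqP/val_inj-> //]]|iA]; exists i; rewrite eqxx.
have -> : #|A| = (\sum_(0 <= i < N) P i)%N.
  by rewrite big_mkord -sum1_card big_mkcond; apply: eq_bigr => i _; rewrite PE; case: ifP.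
rewrite -sum_pairs_pred -prodrXr big_mkord.
rewrite (exchange_big_dep xpredT) //=; apply: eq_bigr => j _.
rewrite big_mkord (big_ord_widen N (fun s => nat_of_bool (P s))) ?(ltnW (ltn_ord j)) // PE.
rewrite mulnC big_distrl /= -prodrXr; apply: eq_bigr => i _.
by rewrite PE; case: (i \in A); case: (j \in A); rewrite ?mul1n ?mul0n ?expr0 ?expr1.
Qed.

(** In the Leibniz expansion, the term of a permutation s times the product of the X + t^j equals,
    up to sign, the product over i of X x_i^(s i) + (t x_i)^(s i). Choosing the first summand for i
    in I and the second elsewhere gives X^|I| times a term of the Vandermonde determinant with x_i
    replaced by t x_i outside I. *)
Lemma det_Vandermonde_twisted (F : fieldType) (N : nat) (x : 'I_N -> F) (t : F) :
  \prod_(j < N) ('X + (t ^+ j)%:P) * (\prod_(i < N) \prod_(j < N | (i < j)%N) (x j - x i))%:P =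
  \sum_(I : {set 'I_N}) 'X^#|I| *
    (\prod_(i < N) \prod_(j < N | (i < j)%N)
       ((if j \in I then x j else t * x j) - (if i \in I then x i else t * x i)))%:P.
Proof.
pose vdm (y : 'I_N -> F) := \det (Vandermonde N (\row_i y i)).
have vdmE y : vdm y = \prod_(i < N) \prod_(j < N | (i < j)%N) (y j - y i).
  rewrite /vdm det_Vandermonde; apply: eq_bigr => i _; apply: eq_bigr => j _.
  by rewrite !mxE.
transitivity (\sum_(I : {set 'I_N}) 'X^#|I| *
    (vdm (fun i => if i \in I then x i else t * x i))%:P); last first.
  by apply: eq_bigr => I _; rewrite vdmE.
rewrite -vdmE.
rewrite -[vdm _]det_tr /determinant rmorph_sum big_distrr /=.
under [RHS]eq_bigr => I _ do
  rewrite -[vdm _]det_tr /determinant rmorph_sum big_distrr /=.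
rewrite exchange_big /=; apply: eq_bigr => s _.
transitivity ((-1) ^+ s * \prod_i ('X * ((x i) ^+ s i)%:P + ((t * x i) ^+ s i)%:P)).
  rewrite rmorphM rmorphXn rmorphN rmorph1 mulrCA; congr (_ * _).
  rewrite (reindex_perm s) /= rmorph_prod -big_split; apply: eq_bigr => i _.
  by rewrite !mxE exprMn rmorphM /=; ring.
rewrite bigA_distr big_distrr /=; apply: eq_bigr => I _.
rewrite rmorphM rmorphXn rmorphN rmorph1 mulrCA; congr (_ * _).
rewrite -prodr_const rmorph_prod. rewrite [X in _ = X * _]big_mkcond -big_split /=; apply: eq_bigr => i _.
by rewrite !mxE; case: ifP => _; rewrite ?mul1r.
Qed.

Definition hl_ratio (F : fieldType) (t a b : F) : F := (a - t * b) / (a - b).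

(** Compare pair by pair with the plain Vandermonde product: a pair inside I is unchanged, a pair
    outside I gains t, and a mixed pair gains [hl_ratio]. *)
Lemma twisted_vdm (F : fieldType) (N : nat) (x : 'I_N -> F) (t : F) (I : {set 'I_N}) :
  injective x ->
  \prod_(i < N) \prod_(j < N | (i < j)%N)
       ((if j \in I then x j else t * x j) - (if i \in I then x i else t * x i)) =
  t ^+ 'C(N - #|I|, 2) * (\prod_(i in I) \prod_(j in ~: I) hl_ratio t (x i) (x j)) *
  \prod_(i < N) \prod_(j < N | (i < j)%N) (x j - x i).
Proof.
move=> xI; have -> : (N - #|I|)%N = #|~: I| by rewrite [RHS]cardsCs setCK card_ord.
rewrite -prod_pairs_set.
have -> : \prod_(i in I) \prod_(j in ~: I) hl_ratio t (x i) (x j) =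
   \prod_(i < N) \prod_(j < N | j != i)
      (if (i \in I) && (j \notin I) then hl_ratio t (x i) (x j) else 1).
  rewrite big_mkcond; apply: eq_bigr => i _.
  case: (boolP (i \in I)) => /= iI; last by rewrite big1.
  rewrite big_mkcond [RHS]big_mkcond; apply: eq_bigr => j _; rewrite inE.
  by case: (eqVneq j i) => [->|] /=; rewrite ?iI.
rewrite big_offdiag -!big_split /=; apply: eq_bigr => i _.
rewrite -!big_split /=; apply: eq_bigr => j ij; rewrite !inE.
have nij : x j - x i != 0 by rewrite subr_eq0 (inj_eq xI) -val_eqE /= gtn_eqF.
have nji : x i - x j != 0 by rewrite -opprB oppr_eq0.
by case: (i \in I); case: (j \in I) => /=; rewrite /hl_ratio; field; rewrite ?nij ?nji.
Qed.

(** The finite q-binomial theorem, by the q-Pascal recursion on [N]. *)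
Lemma prod_XaddC_coef (F : fieldType) (t : F) (N r : nat) :
  (forall k, qpoch t t k != 0) -> (r <= N)%N ->
  (\prod_(j < N) ('X + (t ^+ j)%:P))`_r =
  t ^+ 'C(N - r, 2) * (qpoch t t N / (qpoch t t r * qpoch t t (N - r))).
Proof.
move=> tn0.
have qS k : qpoch t t k.+1 = qpoch t t k * (1 - t ^+ k.+1).
  by rewrite /qpoch big_nat_recr //= -exprS.
have tS k : 1 - t ^+ k.+1 != 0.
  by move: (tn0 k.+1); rewrite qS mulf_eq0 negb_or => /andP[].
elim: N r => [|N IHN] r rN.
  by move: rN; rewrite leqn0 => /eqP->; rewrite big_ord0 coef1 /qpoch big_geq //= mulr1 divr1 mulr1.
have szP : size (\prod_(j < N) ('X + (t ^+ j)%:P)) = N.+1.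
  rewrite -[in RHS](size_enum_ord N) enumT -(size_prod_XsubC _ (fun j : 'I_N => - t ^+ j)).
  rewrite [index_enum _]unlock; congr (size (polyseq _)). 
  by apply: eq_bigr => i _; rewrite polyCN opprK.
rewrite big_ord_recr /= mulrDr coefD coefMX coefMC.
case: r rN => [|r] rN /=.
  rewrite add0r IHN // !subn0 binS bin1 exprD qS.
  have -> : qpoch t t 0 = 1 by rewrite /qpoch big_geq.
  by field; rewrite tn0 tS.
rewrite ltnS in rN; rewrite IHN // subSS.
(* For r = N the coefficient of degree N + 1 vanishes by the size bound [szP]; the quotient formula
   does not cover it. *)
have [lt_rN|] := ltnP r N; last first.
  move=> Nr; have -> : r = N by apply/eqP; rewrite eqn_leq rN.
  rewrite subnn nth_default ?szP // mul0r addr0 qS.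
  have -> : qpoch t t 0 = 1 by rewrite /qpoch big_geq.
  by field; rewrite tn0 tS.
rewrite IHN //; pose d := (N - r.+1)%N.
have e1 : (N - r = d.+1)%N by rewrite /d; lia.
have e2 : (N - r.+1 = d)%N by [].
have e3 : t ^+ N = t ^+ d.+1 * t ^+ r by rewrite -exprD; congr (_ ^+ _); rewrite /d; lia.
have tN := tS N; rewrite e1 e2 !qS binS bin1 exprD; rewrite exprS e3 in tN *.
move: (tS r) (tS d) tN; rewrite !exprS => trS tdS tN.
by field; rewrite ?tn0 ?trS ?tdS.
Qed.

(** Compare the coefficients of X^r in [det_Vandermonde_twisted], after cancelling the nonzero
    Vandermonde product and the power of t from [twisted_vdm]. *)
Lemma sum_subsets_hl_ratio (F : fieldType) (N : nat) (x : 'I_N -> F) (t : F) (r : nat) :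
  injective x -> t != 0 -> (forall k, qpoch t t k != 0) -> (r <= N)%N ->
  \sum_(I : {set 'I_N} | #|I| == r) \prod_(i in I) \prod_(j in ~: I) hl_ratio t (x i) (x j) =
  qpoch t t N / (qpoch t t r * qpoch t t (N - r)).
Proof.
move=> xI t0 tn0 rN; apply: (mulfI (expf_neq0 'C(N - r, 2) t0)).
rewrite -(prod_XaddC_coef tn0 rN).
have := det_Vandermonde_twisted x t.
set D := \prod_(i < N) \prod_(j < N | (i < j)%N) _.
have D0 : D != 0.
  apply/prodf_neq0 => i _; apply/prodf_neq0 => j ij.
  by rewrite subr_eq0 (inj_eq xI) -val_eqE /= gtn_eqF.
under [in RHS]eq_bigr => I _ do rewrite (twisted_vdm _ _ xI) -/D rmorphM mulrA.
rewrite -big_distrl /= => /mulIf -> //; last by rewrite polyC_eq0.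
rewrite coef_sum big_distrr big_mkcond /=; apply: eq_bigr => I _.
rewrite coefMC coefXn eq_sym; case: eqP => [->|]; last by rewrite mul0r.
by rewrite mul1r.
Qed.

Lemma sum_hl_ratio (F : fieldType) (N : nat) (x : 'I_N -> F) (t : F) :
  injective x -> t != 0 -> (forall k, qpoch t t k != 0) ->
  \sum_(i < N) \prod_(j < N | j != i) hl_ratio t (x i) (x j) = (1 - t ^+ N) / (1 - t).
Proof.
move=> xI t0 tn0; case: N x xI => [|N] x xI.
  by rewrite big_ord0 expr0 subrr mul0r.
have q1 : qpoch t t 1 = 1 - t by rewrite /qpoch big_nat1 expr0 mulr1.
transitivity (qpoch t t N.+1 / (qpoch t t 1 * qpoch t t (N.+1 - 1))).
  rewrite -(sum_subsets_hl_ratio xI) //.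
  rewrite (reindex_onto (fun i => [set i]) (fun I => odflt ord0 [pick i in I])); last first.
    move=> I /cards1P[i ->]; congr [set _].
    by case: pickP => [j|/(_ i)]; rewrite !inE ?eqxx // => /eqP.
  apply: eq_big => [i|i _].
    rewrite cards1 eqxx /=; symmetry; apply/eqP.
    by case: pickP => [j|/(_ i)]; rewrite !inE ?eqxx // => /eqP.
  by rewrite big_set1; apply: eq_bigl => j; rewrite !inE.
have qS k : qpoch t t k.+1 = qpoch t t k * (1 - t ^+ k.+1).
  by rewrite /qpoch big_nat_recr //= -exprS.
rewrite subn1 q1 qS /= [qpoch _ _ _ * _]mulrC -mulf_div divff ?mulr1 //.
Qed.

Lemma sum_hl_ratio_set (F : fieldType) (N : nat) (x : 'I_N -> F) (t : F) (A : {set 'I_N}) :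
  injective x -> t != 0 -> (forall k, qpoch t t k != 0) ->
  \sum_(i in A) \prod_(j in A :\ i) hl_ratio t (x i) (x j) = (1 - t ^+ #|A|) / (1 - t).
Proof.
move=> xI t0 tn0.
have yI : injective (x \o @enum_val _ A) by move=> i j /xI /enum_val_inj.
rewrite -(sum_hl_ratio yI t0 tn0) big_enum_val; apply: eq_bigr => i _.
rewrite big_mkcond [RHS]big_mkcond /=.
transitivity (\prod_(j in A) if j \in A :\ enum_val i then hl_ratio t (x (enum_val i)) (x j) else 1).
  by rewrite [RHS]big_mkcond; apply: eq_bigr => j _; rewrite !inE; case: (j \in A); rewrite ?andbF.
rewrite big_enum_val; apply: eq_bigr => j _.
by rewrite !inE enum_valP andbT (inj_eq (@enum_val_inj _ _)).
Qed.

(** * From sums over permutations to sums over subsets *)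

Lemma sum_perm_lift (R : nmodType) (N : nat) (G : 'S_N.+1 -> R) :
  \sum_(w : 'S_N.+1) G w = \sum_(i < N.+1) \sum_(s : 'S_N) G (lift_perm ord0 i s).
Proof.
rewrite pair_big /= (reindex (fun p : 'I_N.+1 * 'S_N => lift_perm ord0 p.1 p.2)) //.
apply/onW_bij/inj_card_bij; last by rewrite card_prod !card_Sn card_ord factS.
move=> [i s] [j u] /= /permP E.
have := E ord0; rewrite !lift_perm_id => ij; rewrite -{}ij in E *; congr pair.
by apply/permP => k; have := E (lift ord0 k); rewrite !lift_perm_lift => /lift_inj.
Qed.

(** With [g i = x i ^+ m] these are the summands of P_(m^r). The weight [g] is left free so that
    [g = 1] covers the q-binomial sum as well. *)
Definition hl_subset_term (F : fieldType) (N : nat) (x g : 'I_N -> F) (t : F) (I : {set 'I_N}) : F :=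
  (\prod_(i in I) g i) * \prod_(i in I) \prod_(j in ~: I) hl_ratio t (x i) (x j).

(** The left side pairs i with every other point, whereas the term of the enlarged set pairs it only
    with points outside; the extra product on the right restores the pairs of i with J. *)
Lemma hl_subset_term_lift (F : fieldType) (N : nat) (x g : 'I_N.+1 -> F) (t : F)
    (i : 'I_N.+1) (J : {set 'I_N}) :
  g i * \prod_(j < N) hl_ratio t (x i) (x (lift i j)) *
    hl_subset_term (x \o lift i) (g \o lift i) t J =
  hl_subset_term x g t (i |: lift i @: J) *
    \prod_(j in lift i @: J) hl_ratio t (x i) (x j).
Proof.
have liftI : injective (lift i) by exact: lift_inj.
have niJ (A : {set 'I_N}) : i \notin lift i @: A.
  by apply/imsetP => -[k _] /eqP; rewrite (negPf (neq_lift i k)).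
have cE : ~: (i |: lift i @: J) = lift i @: (~: J).
  apply/setP => k; rewrite !inE; case: (unliftP i k) => [k' ->|->].
    by rewrite !mem_imset // inE eq_sym (negPf (neq_lift i k')).
  by rewrite eqxx !(negPf (niJ _)).
rewrite /hl_subset_term cE !big_setU1 ?niJ //=.
have -> : \prod_(j < N) hl_ratio t (x i) (x (lift i j)) =
   (\prod_(j in lift i @: J) hl_ratio t (x i) (x j)) *
   \prod_(j in lift i @: (~: J)) hl_ratio t (x i) (x j).
  rewrite big_imset 1?[in X in _ * X]big_imset /=; try by move=> ? ? _ _; exact: liftI.
  by rewrite (bigID (mem J)) /=; congr (_ * _); apply: eq_bigl => j; rewrite inE.
rewrite [\prod_(k in lift i @: J) g k]big_imset /=; last by move=> ? ? _ _; exact: liftI.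
rewrite [\prod_(k in lift i @: J) \prod_(j in _) _]big_imset /=; last by move=> ? ? _ _; exact: liftI.
set A := \prod_(k in J) \prod_(j in _) _; set B := \prod_(k in J) \prod_(j in _) _.
have -> : A = B; last by ring.
by apply: eq_bigr => k _; rewrite big_imset //= => ? ? _ _; exact: liftI.
Qed.

(** Double counting of pairs i in I, weighted: for fixed I the sum over i in I is given by
    [sum_hl_ratio_set] and depends only on #|I|. The factor (1 - t^(r+1)) / (1 - t) is the
    t-analogue of r + 1. *)
Lemma sum_hl_subset_term_lift (F : fieldType) (N : nat) (x g : 'I_N.+1 -> F) (t : F) (r : nat) :
  injective x -> t != 0 -> (forall k, qpoch t t k != 0) ->
  \sum_(i < N.+1) g i * (\prod_(j < N) hl_ratio t (x i) (x (lift i j))) *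
    \sum_(J : {set 'I_N} | #|J| == r) hl_subset_term (x \o lift i) (g \o lift i) t J =
  (1 - t ^+ r.+1) / (1 - t) *
    \sum_(I : {set 'I_N.+1} | #|I| == r.+1) hl_subset_term x g t I.
Proof.
move=> xI t0 tn0; rewrite big_distrr /=.
transitivity (\sum_(i < N.+1) \sum_(I : {set 'I_N.+1} | (i \in I) && (#|I| == r.+1))
   hl_subset_term x g t I * \prod_(j in I :\ i) hl_ratio t (x i) (x j)).
  apply: eq_bigr => i _; rewrite big_distrr /=.
  have liftI : injective (lift i) by exact: lift_inj.
  have niJ (A : {set 'I_N}) : i \notin lift i @: A.
    by apply/imsetP => -[k _] /eqP; rewrite (negPf (neq_lift i k)).
  rewrite [RHS](reindex_onto (fun J : {set _} => i |: lift i @: J) (fun I : {set _} => lift i @^-1: I)).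
    apply: eq_big => [J|J _].
      rewrite setU11 cardsU1 niJ card_imset //= add1n eqSS.
      have -> : lift i @^-1: (i |: lift i @: J) = J; last by rewrite eqxx andbT.
      by apply/setP => k; rewrite !inE mem_imset // eq_sym (negPf (neq_lift i k)).
    rewrite hl_subset_term_lift; congr (_ * _); apply: eq_bigl => j.
    by rewrite setU1K // niJ.
  move=> I /andP[iI _]; apply/setP => k; rewrite !inE.
  case: (unliftP i k) => [k' ->|->]; last by rewrite eqxx iI.
  by rewrite mem_imset // inE eq_sym (negPf (neq_lift i k')).
rewrite (exchange_big_dep (fun I : {set 'I_N.+1} => #|I| == r.+1)) /=; last first.
  by move=> i I _ /andP[].
apply: eq_bigr => I cI; rewrite mulrC -(eqP cI) -(sum_hl_ratio_set I xI t0 tn0).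
by rewrite big_distrr /=; apply: eq_bigl => i; rewrite eqxx andbT.
Qed.

Lemma sum_hl_subset_term0 (F : fieldType) (N : nat) (x g : 'I_N -> F) (t : F) :
  \sum_(I : {set 'I_N} | #|I| == 0%N) hl_subset_term x g t I = 1.
Proof.
rewrite (big_pred1 set0) => [|I]; last by rewrite cards_eq0.
by rewrite /hl_subset_term !big_set0 mulr1.
Qed.

(** Induction on [N], splitting off the image i of position 0. While r > 0, i joins the subset by
    [sum_hl_subset_term_lift]; for r = 0 no weight is left and [sum_hl_ratio] supplies the
    factor. *)
Lemma sum_perm_hl (F : fieldType) (N r m : nat) (x : 'I_N -> F) (t : F) :
  injective x -> t != 0 -> (forall k, qpoch t t k != 0) -> (r <= N)%N ->
  \sum_(w : 'S_N)
       (\prod_(i < N) x (w i) ^+ nth 0%N (nseq r m) i) *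
       (\prod_(i < N) \prod_(j < N | (i < j)%N) hl_ratio t (x (w i)) (x (w j))) =
  (qpoch t t r / (1 - t) ^+ r) * (qpoch t t (N - r) / (1 - t) ^+ (N - r)) *
  \sum_(I : {set 'I_N} | #|I| == r) hl_subset_term x (fun i => x i ^+ m) t I.
Proof.
move=> xI t0 tn0.
have qS k : qpoch t t k.+1 = qpoch t t k * (1 - t ^+ k.+1).
  by rewrite /qpoch big_nat_recr //= -exprS.
have q0 : qpoch t t 0 = 1 by rewrite /qpoch big_geq.
have t1 : 1 - t != 0 by move: (tn0 1); rewrite qS q0 mul1r expr1.
elim: N r x xI => [|N IHN] r x xI.
  rewrite leqn0 => /eqP->; rewrite sum_hl_subset_term0 q0 expr0 divr1 !mulr1.
  by under eq_bigr do rewrite !big_ord0 mulr1; rewrite sumr_const card_Sn.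
move=> rN; rewrite sum_perm_lift.
pose l (i : 'I_N.+1) := x \o lift i.
have lI i : injective (l i) by move=> j k /xI /lift_inj.
(* Position 0 carries the part m unless r = 0, and the remaining positions carry the parts of
   (m^(r-1)). *)
transitivity (\sum_(i < N.+1) (x i ^+ (if r is 0 then 0 else m)) *
    (\prod_(j < N) hl_ratio t (x i) (x (lift i j))) *
   \sum_(w : 'S_N) (\prod_(j < N) l i (w j) ^+ nth 0%N (nseq r.-1 m) j) *
       (\prod_(a < N) \prod_(b < N | (a < b)%N) hl_ratio t (l i (w a)) (l i (w b)))).
  apply: eq_bigr => i _; rewrite [RHS]big_distrr /=; apply: eq_bigr => s _.
  rewrite !big_ord_recl lift_perm_id [\prod_(j < N.+1 | _) _]big_mkcond big_ord_recl /= mul1r.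
  have -> : \prod_(j < N) hl_ratio t (x i) (x (lift i j)) =
    \prod_(j < N) hl_ratio t (x i) (x (lift_perm ord0 i s (lift ord0 j))).
    by rewrite (reindex_perm s); apply: eq_bigr => j _; rewrite lift_perm_lift.
  have -> : \prod_(j < N) l i (s j) ^+ nth 0%N (nseq r.-1 m) j =
     \prod_(j < N) x (lift_perm ord0 i s (lift ord0 j)) ^+ nth 0%N (nseq r m) (lift ord0 j).
    apply: eq_bigr => j _; rewrite lift_perm_lift.
    by case: (r) => //= ; rewrite nth_nil.
  have -> : \prod_(a < N) \prod_(b < N | (a < b)%N) hl_ratio t (l i (s a)) (l i (s b)) =
     \prod_(i0 < N) \prod_(j < N.+1 | (lift ord0 i0 < j)%N)
        hl_ratio t (x (lift_perm ord0 i s (lift ord0 i0))) (x (lift_perm ord0 i s j)).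
    apply: eq_bigr => a _; rewrite [RHS]big_mkcond big_ord_recl /= mul1r -big_mkcond /=.
    by apply: eq_bigr => b _; rewrite !lift_perm_lift.
  have -> : nth 0%N (nseq r m) 0 = if r is 0 then 0%N else m by case: (r).
  by ring.
case: r rN => [_|r rN] /=.
  under eq_bigr => i _ do
    rewrite (IHN 0%N (l i) (lI i) (leq0n N)) sum_hl_subset_term0 subn0 q0 expr0 mul1r.
  have st := sum_hl_ratio xI t0 tn0.
  rewrite sum_hl_subset_term0 q0 expr0 subn0 qS -big_distrl /=.
  have -> : \sum_(i < N.+1) \prod_(j < N) hl_ratio t (x i) (x (lift i j)) = (1 - t ^+ N.+1) / (1 - t).
    rewrite -st; apply: eq_bigr => i _.
    transitivity (\prod_(j in lift i @: setT) hl_ratio t (x i) (x j)).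
      rewrite big_imset /=; last by move=> ? ? _ _; exact: lift_inj.
      by apply: eq_bigl => j; rewrite inE.
    apply: eq_bigl => k; case: (unliftP i k) => [k' ->|->].
      by rewrite mem_imset ?inE 1?eq_sym ?neq_lift //; exact: lift_inj.
    by rewrite eqxx; apply/negbTE/imsetP => -[k' _] /eqP; rewrite (negPf (neq_lift i k')).
  by rewrite [(1 - t) ^+ N.+1]exprS; field; rewrite expf_neq0 ?t1 ?oner_neq0.
under eq_bigr => i _ do rewrite (IHN r (l i) (lI i) rN) mulrCA.
rewrite -big_distrr /= (sum_hl_subset_term_lift (fun i => x i ^+ m) r xI t0 tn0) subSS qS [(1 - t) ^+ r.+1]exprS.
set S := \sum_(I | _) _; by field; rewrite ?t1 ?oner_neq0 ?expf_neq0.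
Qed.

(** * Evaluation of Hall-Littlewood polynomials at q^i *)

(** The prefactor in [sum_perm_hl] is exactly [hl_v], so it cancels. For r > N both sides are
    zero. *)
Lemma hall_littlewood_nseq (F : fieldType) (N r m : nat) (x : 'I_N -> F) (t : F) :
  injective x -> t != 0 -> (forall k, qpoch t t k != 0) -> (0 < r)%N -> (0 < m)%N ->
  hall_littlewood x t (nseq r m) =
  \sum_(I : {set 'I_N} | #|I| == r) hl_subset_term x (fun i => x i ^+ m) t I.
Proof.
move=> xI t0 tn0 r0 m0; rewrite /hall_littlewood /nonzero_parts count_nseq /=.
rewrite -lt0n m0 mul1n; case: leqP => [rN|Nr]; last first.
  rewrite big_pred0 // => I; apply/negbTE; rewrite neq_ltn; apply/orP; left.
  by apply: leq_ltn_trans Nr; rewrite -[X in (_ <= X)%N]card_ord max_card.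
have q0 : qpoch t t 0 = 1 by rewrite /qpoch big_geq.
have t1 : 1 - t != 0.
  by move: (tn0 1); rewrite /qpoch big_nat1 expr0 mulr1.
rewrite (sum_perm_hl m xI t0 tn0 rN).
have -> : hl_v N (nseq r m) t =
   (qpoch t t r / (1 - t) ^+ r) * (qpoch t t (N - r) / (1 - t) ^+ (N - r)).
  (* Only the parts 0 and m can have nonzero multiplicity, namely N - r and r; all the other factors
     of [hl_v] are 1. *)
  have mE : (\max_(k <- nseq r m) k)%N = m.
    case: (r) r0 => // r' _; rewrite big_nseq; elim: r' => [|r' IH]; first exact: maxn0.
    by rewrite iterS IH maxnn.
  rewrite /hl_v mE big_nat_recl // big_mkord; case: m m0 {mE} => // m _.
  rewrite big_ord_recr /= big1 => [|i _].
    by rewrite mul1r mulrC /nonzero_parts !count_nseq /= eqxx !mul1n.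
  by rewrite count_nseq /= eqSS gtn_eqF ?ltn_ord // mul0n q0 expr0 divr1.
by rewrite mulKf // !mulf_neq0 ?invr_eq0 ?expf_neq0.
Qed.

(** * Residue classes and initial segments *)

(** For b < n, the number of i < N congruent to b modulo n. *)
Definition class_size (n N b : nat) : nat := (N %/ n + (b < N %% n))%N.

Lemma ltn_class_size (n N b s : nat) : (b < n)%N ->
  (s < class_size n N b)%N = (b + n * s < N)%N.
Proof.
move=> bn; have n0 : (0 < n)%N by lia.
rewrite /class_size [in RHS](divn_eq N n); move: (ltn_pmod N n0).
move: (N %/ n)%N (N %% n)%N => u v vn.
case: (ltnP b v) => /= bv; nia.
Qed.

Definition residue (n : nat) (n0 : (0 < n)%N) (i : nat) : 'I_n := Ordinal (ltn_pmod i n0).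

(** Induction on [N]: the new index N extends only its own residue class, by one element at position
    N / n. *)
Lemma big_residues (R : Type) (idx : R) (op : Monoid.com_law idx)
    (n : nat) (n0 : (0 < n)%N) (N : nat) (f : 'I_n -> nat -> R) :
  \big[op/idx]_(i < N) f (residue n0 i) (i %/ n)%N =
  \big[op/idx]_(b < n) \big[op/idx]_(s < class_size n N b) f b s.
Proof.
elim: N => [|N IHN].
  rewrite big_ord0 big1 // => b _; rewrite big1 // => s _.
  by case: s => s; rewrite /class_size div0n mod0n ltn0.
have szN : class_size n N (residue n0 N) = (N %/ n)%N.
  by rewrite /class_size ltnn addn0.
have szS (b : 'I_n) : class_size n N.+1 b = (class_size n N b + (b == residue n0 N))%N.
  rewrite /class_size divnS // modnS -val_eqE /=.
  have := ltn_pmod N n0; have := ltn_ord b.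
  have : (n %| N.+1)%N -> (N %% n).+1 = n.
    move=> /dvdnP[c cE]; move: (divn_eq N n) (ltn_pmod N n0) cE.
    move: (N %/ n)%N (N %% n)%N => u v -> vn cE.
    have : (c = u.+1)%N by nia.
    by move=> cu; rewrite cu in cE; nia.
  by case: (n %| N.+1)%N => [/(_ isT)|_] /=; case: ltngtP => /=; case: ltnP; lia.
rewrite big_ord_recr IHN [RHS](bigD1 (residue n0 N)) // [in LHS](bigD1 (residue n0 N)) //.
rewrite szS eqxx addn1 big_ord_recr szN -!Monoid.mulmA /=; congr (op _ _).
rewrite Monoid.mulmC; congr (op _ _); apply: eq_bigr => b /= /negPf nb.
by rewrite szS nb addn0.
Qed.

(** The first [k b] elements of each residue class b. Bounding the lengths by r makes the functions
    [k] a finite type, over which one can sum. *)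
Definition segments (n : nat) (n0 : (0 < n)%N) (N r : nat) (k : {ffun 'I_n -> 'I_r.+1}) :
  {set 'I_N} := [set i : 'I_N | (i %/ n < k (residue n0 i))%N].

Lemma big_segments (R : Type) (idx : R) (op : Monoid.com_law idx)
    (n : nat) (n0 : (0 < n)%N) (N r : nat) (k : {ffun 'I_n -> 'I_r.+1}) (f : 'I_n -> nat -> R) :
  (forall b, k b <= class_size n N b)%N ->
  \big[op/idx]_(i in segments n0 N k) f (residue n0 i) (i %/ n)%N =
  \big[op/idx]_(b < n) \big[op/idx]_(s < k b) f b s.
Proof.
move=> fit; rewrite big_mkcond.
transitivity (\big[op/idx]_(i < N) (fun b s => if (s < k b)%N then f b s else idx)
                                    (residue n0 i) (i %/ n)%N).
  by apply: eq_bigr => i _; rewrite inE.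
rewrite (big_residues op n0 N (fun b s => if (s < k b)%N then f b s else idx)); apply: eq_bigr => b _.
by rewrite -big_mkcond /= (big_ord_widen _ (f b) (fit b)).
Qed.

Lemma big_segmentsC (R : Type) (idx : R) (op : Monoid.com_law idx)
    (n : nat) (n0 : (0 < n)%N) (N r : nat) (k : {ffun 'I_n -> 'I_r.+1}) (f : 'I_n -> nat -> R) :
  \big[op/idx]_(i in ~: segments n0 N k) f (residue n0 i) (i %/ n)%N =
  \big[op/idx]_(b < n) \big[op/idx]_(k b <= s < class_size n N b) f b s.
Proof.
rewrite big_mkcond.
transitivity (\big[op/idx]_(i < N) (fun b s => if (k b <= s)%N then f b s else idx)
                                    (residue n0 i) (i %/ n)%N).
  by apply: eq_bigr => i _; rewrite !inE -leqNgt.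
rewrite (big_residues op n0 N (fun b s => if (k b <= s)%N then f b s else idx)); apply: eq_bigr => b _.
by rewrite -big_mkcond /= big_geq_mkord.
Qed.

Lemma card_segments (n : nat) (n0 : (0 < n)%N) (N r : nat) (k : {ffun 'I_n -> 'I_r.+1}) :
  (forall b, k b <= class_size n N b)%N -> #|segments n0 N k| = (\sum_(b < n) k b)%N.
Proof.
move=> fit; rewrite -sum1_card (big_segments _ _ (fun _ _ => 1%N) fit).
by apply: eq_bigr => b _; rewrite sum1_card card_ord.
Qed.

(** What telescoping leaves of the factors between the point [X a s] and the complement: class b
    runs from [k b] to its end [z b]. *)
Definition segment_ratio (F : fieldType) (n : nat) (X : 'I_n -> nat -> F)
    (z k : 'I_n -> nat) (a : 'I_n) (s : nat) : F :=
  \prod_(b < n) ((X a s - X b (z b)) / (X a s - X b (k b))).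

(** As multiplication by t moves one step along a class, [hl_ratio] is a quotient of consecutive
    differences [f s.+1 / f s], and the product over each class telescopes. *)
Lemma hl_subset_term_segments (F : fieldType) (n : nat) (n0 : (0 < n)%N) (N r : nat)
    (X G : 'I_n -> nat -> F) (t : F) (k : {ffun 'I_n -> 'I_r.+1}) :
  (forall a s, t * X a s = X a s.+1) ->
  (forall a b s u, X a s = X b u -> a = b /\ s = u) ->
  (forall b, k b <= class_size n N b)%N ->
  hl_subset_term (fun i : 'I_N => X (residue n0 i) (i %/ n)%N)
     (fun i : 'I_N => G (residue n0 i) (i %/ n)%N) t (segments n0 N k) =
  \prod_(a < n) \prod_(s < k a) (G a s * segment_ratio X (class_size n N) (fun b => k b) a s).
Proof.
move=> tX XI fit; rewrite /hl_subset_term -big_split /=.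
rewrite -(big_segments _ _ (fun a s => G a s * segment_ratio X (class_size n N) (fun b => k b) a s) fit).
apply: eq_bigr => i; rewrite inE => ik; congr (_ * _).
rewrite (big_segmentsC _ _ _ _ (fun b s => hl_ratio t (X (residue n0 i) (i %/ n)%N) (X b s))).
apply: eq_bigr => b _; rewrite /hl_ratio.
pose f s := X (residue n0 i) (i %/ n)%N - X b s.
under eq_bigr do rewrite tX -/(f _) -/(f _.+1).
have f0 s : (k b <= s)%N -> f s != 0.
  move=> ks; rewrite /f subr_eq0; apply/eqP => /XI[ab us].
  by move: ik; rewrite ab us ltnNge ks.
rewrite -/(f (k b)) -/(f (class_size n N b)).
transitivity (\prod_(k b <= s < class_size n N b) (f s.+1 / f s)).
  by apply: eq_bigr.
have := fit b; rewrite leq_eqVlt => /orP[/eqP <-|kL].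
  by rewrite big_geq // divff // f0.
by apply: telescope_prodf => // s /andP[/ltnW /f0].
Qed.

(** The point of i is t times that of j, so the numerator of the factor (i, j) vanishes. Hence only
    sets that are initial segments in every class contribute. *)
Lemma hl_subset_term_eq0 (F : fieldType) (n : nat) (n0 : (0 < n)%N) (N : nat)
    (X : 'I_n -> nat -> F) (g : 'I_N -> F) (t : F) (I : {set 'I_N}) (i j : 'I_N) :
  (forall a s, t * X a s = X a s.+1) ->
  i \in I -> j \notin I -> (i = j + n :> nat)%N ->
  hl_subset_term (fun i : 'I_N => X (residue n0 i) (i %/ n)%N) g t I = 0.
Proof.
move=> tX iI jI ij; rewrite /hl_subset_term (bigD1 i iI) /= [X in _ * X](bigD1 i iI) /=.
rewrite [X in _ * (X * _)](bigD1 j) ?inE //= /hl_ratio tX.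
have -> : residue n0 i = residue n0 j by apply: val_inj; rewrite /= ij modnDr.
by rewrite ij divnDr ?dvdnn // divnn n0 addn1 subrr !mul0r mulr0.
Qed.

Lemma initial_segment (P : pred nat) (L s : nat) :
  (forall u, P u.+1 -> P u) -> (s < L)%N -> P s = (s < \sum_(u < L) P u)%N.
Proof.
move=> dP; have dP' u v : (u <= v)%N -> P v -> P u.
  by move=> /subnK <-; elim: (v - u)%N => // d IH /dP.
have [M ML PM] : exists2 M, (M <= L)%N & forall u, (u < L)%N -> P u = (u < M)%N.
  elim: L {s} => [|L [M ML PM]]; first by exists 0%N.
  have [PL|PL] := boolP (P L).
    by exists L.+1 => // u; rewrite ltnS => uL; rewrite uL; apply: dP' PL.
  exists M; first exact: leqW.
  move=> u; rewrite ltnS leq_eqVlt => /orP[/eqP->|/PM //].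
  by rewrite (negPf PL) ltnNge ML.
move=> sL; rewrite PM //; congr (_ < _)%N.
transitivity (\sum_(u < M) 1)%N; first by rewrite sum1_card card_ord.
by rewrite (big_ord_widen L (fun=> 1%N) ML) big_mkcond; apply: eq_bigr => u _; rewrite PM //; case: ltnP.
Qed.

(** The sets closed under i |-> i - n correspond to the length functions [k] that fit into the
    classes. All other sets, and all other [k], contribute zero. *)
Lemma sum_hl_subset_term_segments (F : fieldType) (n : nat) (n0 : (0 < n)%N) (N r : nat)
    (X G : 'I_n -> nat -> F) (t : F) :
  (forall a s, t * X a s = X a s.+1) ->
  (forall a b s u, X a s = X b u -> a = b /\ s = u) ->
  \sum_(I : {set 'I_N} | #|I| == r)
    hl_subset_term (fun i : 'I_N => X (residue n0 i) (i %/ n)%N)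
     (fun i : 'I_N => G (residue n0 i) (i %/ n)%N) t I =
  \sum_(k : {ffun 'I_n -> 'I_r.+1} | (\sum_(b < n) k b == r)%N)
  \prod_(a < n) \prod_(s < k a) (G a s * segment_ratio X (class_size n N) (fun b => k b) a s).
Proof.
move=> tX XI; pose fits (k : {ffun 'I_n -> 'I_r.+1}) := [forall b, k b <= class_size n N b]%N.
rewrite [RHS](bigID fits) /= [X in _ + X]big1 ?addr0; last first.
  move=> k /andP[_] /forallPn[b]; rewrite -ltnNge => bk.
  (* If [k b] exceeds the class size, the index s equal to that size occurs and makes the numerator
     for class b zero. *)
  rewrite (bigD1 b) //= (bigD1 (Ordinal bk)) //= /segment_ratio (bigD1 b) //=.
  by rewrite subrr !mul0r mulr0 !mul0r.
pose closed (I : {set 'I_N}) := [forall i : 'I_N, forall j : 'I_N,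
   ((i \in I) && (i == j + n :> nat)%N) ==> (j \in I)].
rewrite (bigID closed) /= [X in _ + X]big1 ?addr0; last first.
  move=> I /andP[_] /forallPn[i] /forallPn[j]; rewrite negb_imply => /andP[/andP[iI /eqP ij] jI].
  exact: hl_subset_term_eq0 tX iI jI ij.
pose mem (I : {set 'I_N}) (b : 'I_n) s := [exists i : 'I_N, (i == b + n * s :> nat)%N && (i \in I)].
pose count (I : {set 'I_N}) (b : 'I_n) := (\sum_(s < class_size n N b) mem I b s)%N.
have memE (I : {set 'I_N}) (i : 'I_N) : (i \in I) = mem I (residue n0 i) (i %/ n)%N.
  have iE : (i = residue n0 i + n * (i %/ n) :> nat)%N.
    by rewrite {1}(divn_eq i n) addnC mulnC.
  apply/idP/existsP => [iI|[j /andP[/eqP ji jI]]]; first by exists i; rewrite -iE eqxx.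
  by have -> : i = j by apply: val_inj; rewrite /= ji.
have mem_seg k (b : 'I_n) s : (s < class_size n N b)%N -> mem (segments n0 N k) b s = (s < k b)%N.
  rewrite ltn_class_size // => sN; pose i := Ordinal sN.
  have rb : residue n0 i = b by apply: val_inj; rewrite /= addnC mulnC modnMDl modn_small.
  have rs : (i %/ n = s)%N by rewrite /= addnC mulnC divnMDl // divn_small ?addn0.
  by rewrite -{1}rb -{1}rs -memE inE rb rs.
have closed_seg k : closed (segments n0 N k).
  apply/forallP => i; apply/forallP => j; apply/implyP => /andP[]; rewrite !inE => ik /eqP ij.
  have -> : residue n0 j = residue n0 i by apply: val_inj; rewrite /= ij modnDr.
  by apply: leq_ltn_trans ik; rewrite ij leq_div2r // leq_addr.
have count_le I b : (count I b <= class_size n N b)%N.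
  rewrite -[X in (_ <= X)%N]card_ord -sum1_card; apply: leq_sum => s _.
  exact: leq_b1.
have closedP I i : closed I -> (i \in I) = (i %/ n < count I (residue n0 i))%N.
  move=> cI; rewrite memE.
  have iL : (i %/ n < class_size n N (residue n0 i))%N.
    by rewrite ltn_class_size ?ltn_pmod // addnC mulnC -divn_eq.
  apply: initial_segment iL => u /existsP[j /andP[/eqP jE jI]].
  have uN : (residue n0 i + n * u < N)%N by rewrite (leq_trans _ (ltn_ord j)) // jE; lia.
  apply/existsP; exists (Ordinal uN); rewrite eqxx /=.
  move/forallP/(_ j)/forallP/(_ (Ordinal uN)): cI; rewrite jI /= jE mulnS.
  by move/implyP; apply; apply/eqP; rewrite /=; lia.
have count_card I : closed I -> #|I| = (\sum_(b < n) count I b)%N.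
  move=> cI; rewrite -sum1_card big_mkcond /=.
  transitivity (\sum_(i < N) (fun b s => (mem I b s : nat)) (residue n0 i) (i %/ n))%N.
    by apply: eq_bigr => i _; rewrite -memE; case: (i \in I).
  exact: (big_residues _ n0 N (fun b s => nat_of_bool (mem I b s))).
(* No [count I b] exceeds #|I| = r for closed I, so [inord] does not fall back to its default
   value. *)
rewrite (reindex_onto (@segments n n0 N r) (fun I : {set _} => [ffun b => inord (count I b)])) /=; last first.
  move=> I /andP[/eqP Ir cI]; apply/setP => i; rewrite inE ffunE inordK -?closedP //.
  by rewrite ltnS -Ir count_card // (bigD1 (residue n0 i)) //= leq_addr.
apply: eq_big => [k|k /andP[/andP[_ _] /eqP fk]]; last first.
  apply: hl_subset_term_segments => // b; rewrite -fk ffunE /inord.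
  by rewrite val_insubd; case: ifP => // _; apply: count_le.
rewrite closed_seg andbT.
(* Counting truncates at the class size, so [k] is recovered from its segments exactly when it
   fits. *)
have countE b : count (segments n0 N k) b = minn (k b) (class_size n N b).
  rewrite /count; transitivity (\sum_(s < class_size n N b) (s < k b))%N.
    by apply: eq_bigr => s _; rewrite mem_seg.
  have [kL|Lk] := leqP (k b) (class_size n N b).
    rewrite -[RHS]card_ord -sum1_card (big_ord_widen _ (fun=> 1%N) kL) [RHS]big_mkcond.
    by apply: eq_bigr => s _; case: ltnP.
  rewrite -[RHS]card_ord -sum1_card; apply: eq_bigr => s _.
  by rewrite (ltn_trans _ Lk).
have -> : ([ffun b => inord (count (segments n0 N k) b)] == k) = fits k.
  apply/eqP/forallP => [fk b|fk].
    have := congr1 (fun h : {ffun 'I_n -> 'I_r.+1} => val (h b)) fk.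
    rewrite ffunE /= inordK; last by rewrite countE (leq_ltn_trans (geq_minl _ _)).
    by rewrite countE => /minn_idPl.
  by apply/ffunP => b; apply: val_inj; rewrite ffunE countE (minn_idPl (fk b)) /= inord_val.
have [fk|] := boolP (fits k); last by rewrite !andbF.
by rewrite !andbT card_segments //; exact/forallP.
Qed.

(** * Vandermonde identities *)

(** Simultaneous induction on [k] and [l]: removing the first factor of each product and a factor p
    from every remaining one reduces (k+1, l+1) to (k, l). [base] treats the cases where k or l is
    0. *)
Lemma prod_pair_shift (R : comNzRingType) (u v p : R) (k l : nat) :
  (\prod_(s < k) (u * p ^+ s - v * p ^+ l)) * (\prod_(s < l) (v * p ^+ s - u * p ^+ k)) *
    (u * p ^+ k - v * p ^+ l) =
  (-1) ^+ (k + l) * p ^+ (k * l) * (u - v) *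
    ((\prod_(s < k) (v - u * p ^+ s.+1)) * \prod_(s < l) (u - v * p ^+ s.+1)).
Proof.
have base (a b : R) m : (\prod_(s < m) (a * p ^+ s - b)) * (a * p ^+ m - b) =
    (-1) ^+ m * (a - b) * \prod_(s < m) (b - a * p ^+ s.+1).
  elim: m => [|m IHm]; first by rewrite !big_ord0 expr0; ring.
  by rewrite !big_ord_recr /= IHm !exprS; ring.
elim: k l => [|k IHk] [|l].
- by rewrite !big_ord0; ring.
- rewrite !big_ord0 mul0n expr0 mulr1 !mul1r -opprB mulrN base; ring.
- by rewrite !big_ord0 muln0 !expr0 !mulr1 base addn0.
have {}IHk := IHk l.
rewrite big_ord_recl [X in _ * X * _]big_ord_recl.
under eq_bigr => i _ do rewrite /= /bump /=.
transitivity (p ^+ (k + l).+1 * (u - v * p ^+ l.+1) * (v - u * p ^+ k.+1) *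
  ((\prod_(s < k) (u * p ^+ s - v * p ^+ l)) * (\prod_(s < l) (v * p ^+ s - u * p ^+ k)) *
    (u * p ^+ k - v * p ^+ l))).
  have sh (a b : R) m m' : \prod_(s < m) (a * p ^+ lift ord0 s - b * p ^+ m'.+1) =
     p ^+ m * \prod_(s < m) (a * p ^+ s - b * p ^+ m').
    rewrite -[in p ^+ m](card_ord m) -prodr_const -big_split; apply: eq_bigr => s _ /=.
    by rewrite /bump /= add1n !exprS; ring.
  by rewrite !sh !expr0 !mulr1 !exprS exprD; ring.
by rewrite IHk !big_ord_recr /= mulnS addSn addnS !exprS mulSn !exprD; ring.
Qed.

Lemma bin2_sqr (r : nat) : ('C(r, 2) * 2 + r = r * r)%N.
Proof. by elim: r => // r IH; rewrite binS bin1; nia. Qed.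

Lemma bin2_sum_pairs (n : nat) (k : 'I_n -> nat) :
  'C(\sum_(a < n) k a, 2) =
  (\sum_(a < n) 'C(k a, 2) + \sum_(a < n) \sum_(b < n | (a < b)%N) k a * k b)%N.
Proof.
suff : (('C(\sum_(a < n) k a, 2) * 2 + \sum_(a < n) k a) =
  (\sum_(a < n) 'C(k a, 2) + \sum_(a < n) \sum_(b < n | (a < b)%N) k a * k b) * 2 +
   \sum_(a < n) k a)%N by lia.
rewrite bin2_sqr mulnDl addnAC [X in (X + _ + _)%N]big_distrl /=.
rewrite -[X in (X + _)%N]big_split /=; under [X in (X + _)%N]eq_bigr do rewrite bin2_sqr.
rewrite big_distrl /=.
have -> : ((\sum_(a < n) \sum_(b < n | (a < b)%N) k a * k b) * 2 =
   \sum_(a < n) \sum_(b < n | b != a) k a * k b)%N.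
  rewrite big_offdiag big_distrl; apply: eq_bigr => a _.
  by rewrite big_distrl; apply: eq_bigr => b _ /=; lia.
rewrite -big_split; apply: eq_bigr => a _ /=.
by rewrite big_distrr /= (bigD1 a).
Qed.

(** The identity factors over the indices: [prod_pair_shift] for each pair a < b, and [fg] on the
    diagonal. The powers of p add up by [bin2_sum_pairs]. *)
Lemma vdm_segments (R : comNzRingType) (n : nat) (x : 'I_n -> R) (p : R) (k : 'I_n -> nat) :
  (\prod_(a < n) \prod_(s < k a) \prod_(b < n) (x a * p ^+ s - x b * p ^+ k b)) *
    \prod_(a < n) \prod_(b < n | (a < b)%N) (x a * p ^+ k a - x b * p ^+ k b) =
  (-1) ^+ (n.-1 * \sum_(a < n) k a) * p ^+ 'C(\sum_(a < n) k a, 2) *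
    (\prod_(a < n) \prod_(b < n | (a < b)%N) (x a - x b)) *
    \prod_(c < n) \prod_(s < k c) \prod_(a < n) (x a - x c * p ^+ s.+1).
Proof.
pose f a b := \prod_(s < k a) (x a * p ^+ s - x b * p ^+ k b).
pose g a b := \prod_(s < k a) (x b - x a * p ^+ s.+1).
have -> : \prod_(a < n) \prod_(s < k a) \prod_(b < n) (x a * p ^+ s - x b * p ^+ k b) =
    \prod_(a < n) \prod_(b < n) f a b by apply: eq_bigr => a _; rewrite exchange_big.
have -> : \prod_(c < n) \prod_(s < k c) \prod_(a < n) (x a - x c * p ^+ s.+1) =
    \prod_(a < n) \prod_(b < n) g a b by apply: eq_bigr => a _; rewrite exchange_big.
have fg a : f a a = p ^+ 'C(k a, 2) * g a a.
  rewrite /f /g; elim: (k a) => [|m IHm]; first by rewrite !big_ord0 expr0 mulr1.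
  rewrite big_ord_recl big_ord_recr /= binS bin1 exprD.
  have -> : \prod_(s < m) (x a * p ^+ bump 0 s - x a * p ^+ m.+1) =
      p ^+ m * \prod_(s < m) (x a * p ^+ s - x a * p ^+ m).
    transitivity (\prod_(s < m) (p * (x a * p ^+ s - x a * p ^+ m))).
      by apply: eq_bigr => s _; rewrite /bump /= add1n !exprS; ring.
    by rewrite big_split prodr_const card_ord.
  by rewrite IHm expr0; ring.
rewrite (prod_diag_pairs f) (prod_diag_pairs g) -[LHS]mulrA -big_split /=.
under [X in _ * X]eq_bigr => a _ do rewrite -big_split /=.
(* Each index a lies in n - 1 pairs. *)
have -> : (-1) ^+ (n.-1 * \sum_(a < n) k a) =
    \prod_(a < n) \prod_(b < n | (a < b)%N) (-1) ^+ (k a + k b) :> R.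
  rewrite big_distrr -prodrXr /=.
  transitivity (\prod_(a < n) \prod_(b < n | b != a) (-1 : R) ^+ k a).
    apply: eq_bigr => a _; rewrite prodr_const -exprM mulnC; congr (_ ^+ (_ * _)).
    by rewrite -[in LHS](card_ord n) -(cardC1 a); apply: eq_card.
  by rewrite big_offdiag; apply: eq_bigr => a _; apply: eq_bigr => b _; rewrite exprD.
rewrite bin2_sum_pairs exprD -!prodrXr.
under [\prod_(i < n) p ^+ \sum_(b < n | _) _]eq_bigr do rewrite -prodrXr.
under [\prod_(i < n) f i i]eq_bigr do rewrite fg.
rewrite big_split /=; set P1 := \prod_(i < n) p ^+ 'C(_, 2); set P2 := \prod_(i < n) g i i.
set V := \prod_(a < n) \prod_(i < n | _) (f a i * f i a * _).
set S := \prod_(a < n) \prod_(b < n | _) (-1) ^+ _.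
set Q := \prod_(i < n) \prod_(j < n | _) p ^+ _.
set W := \prod_(a < n) \prod_(b < n | _) (x a - x b).
set T := \prod_(a < n) \prod_(b < n | _) (g a b * g b a).
suff -> : V = S * Q * W * T by ring.
rewrite /S /Q /W /T -!big_split /=; apply: eq_bigr => a _.
rewrite -!big_split /=; apply: eq_bigr => b _; exact: prod_pair_shift.
Qed.

Lemma affine_index_inj (K a b s u : nat) : (a < K)%N -> (b < K)%N ->
  (a + K * s = b + K * u)%N -> a = b /\ s = u.
Proof.
move=> aK bK E; suff su : s = u by split=> //; move: E; rewrite su => /addIn.
by have [su|us|//] := ltngtP s u; nia.
Qed.

Lemma affine_index_neq (n K : nat) (a b : 'I_n) (s : nat) (k : 'I_n -> nat) :
  (n <= K)%N -> (s < k a)%N -> (a + K * s != b + K * k b)%N.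
Proof.
move=> nK sk; apply/eqP => /affine_index_inj[||/val_inj ab su]; try exact: leq_trans nK.
by move: sk; rewrite su ab ltnn.
Qed.

(** For K = n this is the sum of the elements of the set with segment lengths [k], and m times it is
    the exponent of the weight. *)
Definition index_sum (n K : nat) (k : 'I_n -> nat) : nat :=
  (\sum_(a < n) \sum_(s < k a) (a + K * s))%N.

Lemma index_sumE (n K : nat) (k : 'I_n -> nat) :
  index_sum K k = (\sum_(a < n) (a * k a + K * 'C(k a, 2)))%N.
Proof.
apply: eq_bigr => a _; elim: (k a) => [|m IH]; first by rewrite big_ord0 !muln0.
by rewrite big_ord_recr /= IH binS bin1; lia.
Qed.

Definition vdm_at (R : pzRingType) (x : R) (n K : nat) (k : 'I_n -> nat) : R :=
  \prod_(a < n) \prod_(b < n | (a < b)%N) (x ^+ (a + K * k a) - x ^+ (b + K * k b)).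

(** Leibniz expansion; the constant product of signs reverses every difference of
    [det_Vandermonde]. *)
Lemma vdm_atE (R : comNzRingType) (x : R) (n K : nat) (k : 'I_n -> nat) :
  vdm_at x K k = (\prod_(a < n) \prod_(b < n | (a < b)%N) -1) *
    \sum_(w : 'S_n) (-1) ^+ w * x ^+ (\sum_(a < n) (a + K * k a) * w a).
Proof.
transitivity ((\prod_(a < n) \prod_(b < n | (a < b)%N) -1) *
   \det (Vandermonde n (\row_(a < n) x ^+ (a + K * k a)))).
  rewrite det_Vandermonde -big_split; apply: eq_bigr => a _; rewrite -big_split.
  by apply: eq_bigr => b _; rewrite !mxE /= mulN1r opprB.
rewrite -det_tr; congr (_ * _); apply: eq_bigr => w _; congr (_ * _).
by rewrite -prodrXr; apply: eq_bigr => a _; rewrite !mxE exprM.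
Qed.

(* Both sides expand to signed sums over pairs (w, k), which correspond to each
   other under (w, k) |-> (w^-1, k o w^-1). *)
Lemma sum_vdm_at_swap (R : comNzRingType) (x : R) (n r K M : nat) :
  \sum_(k : {ffun 'I_n -> 'I_r.+1} | (\sum_(b < n) k b == r)%N)
    x ^+ (M * index_sum K (fun b => k b)) * vdm_at x K (fun b => k b) =
  \sum_(k : {ffun 'I_n -> 'I_r.+1} | (\sum_(b < n) k b == r)%N)
    x ^+ (K * index_sum M (fun b => k b)) * vdm_at x M (fun b => k b).
Proof.
pose e := \prod_(a < n) \prod_(b < n | (a < b)%N) (-1 : R).
pose f K M (w : 'S_n) (k : {ffun 'I_n -> 'I_r.+1}) :=
  (-1) ^+ w * x ^+ (M * index_sum K (fun b => k b) + \sum_(a < n) (a + K * k a) * w a).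
have expand L P : \sum_(k : {ffun 'I_n -> 'I_r.+1} | (\sum_(b < n) k b == r)%N)
    x ^+ (P * index_sum L (fun b => k b)) * vdm_at x L (fun b => k b) =
  e * \sum_(w : 'S_n) \sum_(k : {ffun 'I_n -> 'I_r.+1} | (\sum_(b < n) k b == r)%N) f L P w k.
  rewrite exchange_big big_distrr /=; apply: eq_bigr => k _.
  rewrite vdm_atE mulrCA; congr (_ * _); rewrite big_distrr; apply: eq_bigr => w _.
  by rewrite /f exprD /= mulrCA.
rewrite !expand; congr (_ * _); rewrite [RHS](reindex_inj invg_inj); apply: eq_bigr => w _.
pose h (u : 'S_n) (k : {ffun 'I_n -> 'I_r.+1}) := [ffun a => k (u a)].
have hK u : cancel (h u) (h u^-1%g).
  by move=> k; apply/ffunP => a; rewrite !ffunE permKV.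
rewrite [RHS](reindex_inj (can_inj (hK w^-1%g))); apply: eq_big => [k|k _].
  congr (_ == _); rewrite [RHS](reindex_perm w).
  by apply: eq_bigr => b _; rewrite ffunE permK.
(* The exponent is the sum over a of M K C(k_a, 2) + M a k_a + K k_a w(a) + a w(a); the two middle
   terms trade places. *)
rewrite /f odd_permV; congr (_ * _ ^+ _); rewrite !index_sumE.
rewrite [in RHS](reindex_perm w) [X in (_ = _ + X)%N](reindex_perm w) /=.
rewrite !big_distrr -!big_split /=; apply: eq_bigr => a _.
by rewrite !ffunE !permK; lia.
Qed.

(** This is [vdm_segments] at the points x^a with p = x^K, divided by the product [D] of all the
    denominators. *)
Lemma seg_prod_vdm (F : fieldType) (x : F) (n K : nat) (k : 'I_n -> nat) :
  x != 0 -> (n <= K)%N ->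
  (forall (a b : 'I_n) s, (s < k a)%N -> x ^+ (a + K * s) != x ^+ (b + K * k b)) ->
  (\prod_(a < n) \prod_(s < k a) \prod_(b < n)
      (x ^+ (a + K * s) / (x ^+ (a + K * s) - x ^+ (b + K * k b)))) *
  (\prod_(c < n) \prod_(s < k c) \prod_(a < n) (1 - x ^+ (c + K * s.+1 - a))) *
  ((-1) ^+ (n.-1 * \sum_(a < n) k a) *
     x ^+ (K * 'C(\sum_(a < n) k a, 2) + 'C(n, 2) * \sum_(a < n) k a) *
   \prod_(a < n) \prod_(b < n | (a < b)%N) (x ^+ a - x ^+ b)) =
  x ^+ (n * index_sum K k) * vdm_at x K k.
Proof.
move=> x0 nK ne.
pose D := \prod_(a < n) \prod_(s < k a) \prod_(b < n) (x ^+ (a + K * s) - x ^+ (b + K * k b)).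
have D0 : D != 0.
  apply/prodf_neq0 => a _; apply/prodf_neq0 => s _; apply/prodf_neq0 => b _.
  by rewrite subr_eq0 ne.
have -> : \prod_(a < n) \prod_(s < k a) \prod_(b < n)
      (x ^+ (a + K * s) / (x ^+ (a + K * s) - x ^+ (b + K * k b))) =
    x ^+ (n * index_sum K k) / D.
  rewrite mulnC exprM /index_sum -!prodrXr -prodrXl /D -prodf_div; apply: eq_bigr => a _.
  rewrite -prodrXr -prodrXl -prodf_div; apply: eq_bigr => s _.
  by rewrite prodf_div prodr_const card_ord.
rewrite -!mulrA; congr (_ * _); apply: (mulfI D0); rewrite mulVKf //.
have := vdm_segments (fun a : 'I_n => x ^+ a) (x ^+ K) k.
under eq_bigr => a _ do under eq_bigr => s _ do under eq_bigr => b _ do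
  rewrite -!exprM -!exprD.
under [X in _ * X = _ -> _]eq_bigr => a _ do under eq_bigr => b _ do rewrite -!exprM -!exprD.
rewrite -/D -/(vdm_at x K k) => ->.
(* Factoring x^a out of each difference is possible as a < n <= K, and costs 0 + ... + (n-1) = C(n,
   2) for every pair (c, s). *)
have -> : \prod_(c < n) \prod_(s < k c) \prod_(a < n) (x ^+ a - x ^+ c * (x ^+ K) ^+ s.+1) =
   x ^+ ('C(n, 2) * \sum_(a < n) k a) *
   \prod_(c < n) \prod_(s < k c) \prod_(a < n) (1 - x ^+ (c + K * s.+1 - a)).
  rewrite exprM -prodrXr -big_split; apply: eq_bigr => c _ /=.
  rewrite [X in X * _](_ : _ = \prod_(s < k c) x ^+ 'C(n, 2)); last by rewrite prodr_const card_ord.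
  rewrite -big_split; apply: eq_bigr => s _ /=.
  have -> : 'C(n, 2) = (\sum_(a < n) a)%N by rewrite -bin2_sum big_mkord.
  rewrite -prodrXr -big_split; apply: eq_bigr => a _ /=.
  rewrite mulrBr mulr1 -!exprM -!exprD; congr (_ - _ ^+ _).
  by have := ltn_ord a; nia.
by rewrite exprD -!exprM; ring.
Qed.

(** * Lower bounds for exponents *)

(** Every i in [A] is at least the number of elements of [A] below it. This bound makes the
    normalized sum a power series despite the negative power of q. *)
Lemma bin2_le_sum_set (N : nat) (A : {set 'I_N}) : ('C(#|A|, 2) <= \sum_(i in A) i)%N.
Proof.
pose P s := [exists i : 'I_N, (val i == s) && (i \in A)].
have PE i : P (val i) = (i \in A).
  by apply/existsP/idP => [[j /andP[/eqP/val_inj-> //]]|iA]; exists i; rewrite eqxx.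
have -> : #|A| = (\sum_(0 <= i < N) P i)%N.
  by rewrite big_mkord -sum1_card big_mkcond; apply: eq_bigr => i _; rewrite PE; case: ifP.
rewrite -sum_pairs_pred big_mkord [X in (_ <= X)%N]big_mkcond; apply: leq_sum => i _.
rewrite PE; case: ifP => // _; rewrite mul1n big_mkord.
by rewrite -[X in (_ <= X)%N]card_ord -sum1_card; apply: leq_sum => j _; apply: leq_b1.
Qed.

Lemma bin2_le_index_sum (n r : nat) (k : {ffun 'I_n -> 'I_r.+1}) : (0 < n)%N ->
  ('C(\sum_(b < n) k b, 2) <= index_sum n (fun b => k b))%N.
Proof.
(* With this [N] each class has r + 1 elements, so every [k] fits. *)
move=> n0; pose N := (n * r.+1)%N.
have fit b : (k b <= class_size n N b)%N.
  rewrite /class_size /N mulKn // modnMr addn0; exact: ltnW.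
rewrite -(card_segments n0 fit) (leq_trans (bin2_le_sum_set _)) //.
rewrite /index_sum -(big_segments _ n0 (fun b s => (b + n * s)%N) fit).
apply: leq_sum => i _; by rewrite /= [X in (X <= _)%N](divn_eq i n) addnC mulnC.
Qed.

(** Every s >= d gives a + K s > b + K k_b, hence a summand of at least 1, and class a has at least
    k_a - d such s. *)
Lemma sum_index_lower (n K d r : nat) (k : 'I_n -> nat) (b : 'I_n) :
  (0 < K)%N -> (b + K * k b < d)%N -> (\sum_(a < n) k a = r)%N ->
  (r - n * d <= \sum_(a < n) \sum_(s < k a) \sum_(c < n) (a + K * s - (c + K * k c)))%N.
Proof.
move=> K0 yd <-; apply: (@leq_trans (\sum_(a < n) (k a - d))%N).
  rewrite leq_subLR -[X in (X * d)%N]card_ord -sum_nat_const -big_split /=.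
  by apply: leq_sum => a _; lia.
apply: leq_sum => a _; elim: (k a) => // m IH; rewrite big_ord_recr /=.
apply: leq_trans (leq_add IH (_ : (d <= m)%N <= _)%N); first by lia.
by rewrite (bigD1 b) //=; case: leqP => //= dm; nia.
Qed.

(** * Order of a Laurent series *)

(** In particular [order_ge 0 u] says that u is a power series. *)
Definition order_ge (d : nat) (u : laurent) : Prop :=
  exists b : {fps rat}, u = (fpsX rat ^+ d * b)%:F.

Lemma coef_fpsXnM (R : comNzRingType) (d : nat) (b : {fps R}) (k : nat) :
  (fpsX R ^+ d * b) k = if (k < d)%N then 0 else b (k - d)%N.
Proof.
elim: d k => [|d IHd] k; first by rewrite expr0 mul1r subn0.
by rewrite exprS -mulrA coef_fpsXM; case: k => [|k] //; rewrite IHd ltnS subSS.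
Qed.

Lemma order_ge_fps (d : nat) (a : {fps rat}) :
  (forall k, (k < d)%N -> a k = 0) -> order_ge d a%:F.
Proof.
move=> a0; exists (Fps (fun k => a (k + d)%N)); congr (_%:F); apply: fpsP => k.
by rewrite coef_fpsXnM; case: ltnP => [/a0 //|dk] /=; rewrite subnK.
Qed.

Lemma order_ge_fps0 (a : {fps rat}) : order_ge 0 a%:F.
Proof. exact: order_ge_fps. Qed.

Lemma order_ge1 : order_ge 0 1.
Proof. by rewrite -tofrac1; apply: order_ge_fps0. Qed.

Lemma order_ge_lq (d : nat) : order_ge d (lq ^+ d).
Proof. by exists 1; rewrite mulr1 tofracXn. Qed.

Lemma order_geM (d e : nat) (u v : laurent) :
  order_ge d u -> order_ge e v -> order_ge (d + e) (u * v).
Proof.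
move=> [a ->] [b ->]; exists (a * b); rewrite -tofracM; congr (_%:F).
by rewrite exprD mulrACA.
Qed.

Lemma order_ge_le (d e : nat) (u : laurent) : (e <= d)%N -> order_ge d u -> order_ge e u.
Proof.
move=> ed [a ->]; exists (fpsX rat ^+ (d - e) * a).
by rewrite mulrA -exprD subnKC.
Qed.

Lemma order_geMl (d : nat) (u v : laurent) : order_ge d u -> order_ge 0 v -> order_ge d (u * v).
Proof. by move=> du dv; rewrite -[d]addn0; apply: order_geM. Qed.

Lemma order_geMr (d : nat) (u v : laurent) : order_ge 0 u -> order_ge d v -> order_ge d (u * v).
Proof. by move=> du dv; rewrite mulrC; apply: order_geMl. Qed.

Lemma order_ge0 (d : nat) : order_ge d 0.
Proof. by exists 0; rewrite mulr0 tofrac0. Qed.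

Lemma order_geN (d : nat) (u : laurent) : order_ge d u -> order_ge d (- u).
Proof. by move=> [a ->]; exists (- a); rewrite mulrN tofracN. Qed.

Lemma order_geD (d : nat) (u v : laurent) : order_ge d u -> order_ge d v -> order_ge d (u + v).
Proof. by move=> [a ->] [b ->]; exists (a + b); rewrite mulrDr tofracD. Qed.

Lemma order_geB (d : nat) (u v : laurent) : order_ge d u -> order_ge d v -> order_ge d (u - v).
Proof. by move=> du dv; apply: order_geD => //; apply: order_geN. Qed.

Lemma order_ge_sum (d : nat) (I : Type) (s : seq I) (P : pred I) (f : I -> laurent) :
  (forall i, P i -> order_ge d (f i)) -> order_ge d (\sum_(i <- s | P i) f i).
Proof. by move=> df; apply: big_ind => //; [exact: order_ge0|move=> *; exact: order_geD]. Qed.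

Lemma order_ge_prod (I : Type) (s : seq I) (P : pred I) (f : I -> laurent) (e : I -> nat) :
  (forall i, P i -> order_ge (e i) (f i)) ->
  order_ge (\sum_(i <- s | P i) e i) (\prod_(i <- s | P i) f i).
Proof.
by move=> df; apply: (big_ind2 order_ge) => //; [exact: order_ge1|move=> *; exact: order_geM].
Qed.

Lemma order_ge_prod0 (I : Type) (s : seq I) (P : pred I) (f : I -> laurent) :
  (forall i, P i -> order_ge 0 (f i)) -> order_ge 0 (\prod_(i <- s | P i) f i).
Proof. by move=> df; apply: big_ind => //; [exact: order_ge1|move=> *; exact: order_geMl]. Qed.

(** Congruence modulo q^d between power series; integrality of both sides makes it compatible with
    products. *)
Definition order_close (d : nat) (u v : laurent) : Prop :=
  [/\ order_ge 0 u, order_ge 0 v & order_ge d (u - v)].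

Lemma order_closeM (d : nat) (u v u' v' : laurent) :
  order_close d u v -> order_close d u' v' -> order_close d (u * u') (v * v').
Proof.
move=> [u0 v0 uv] [u0' v0' uv']; split; try exact: order_geMl.
have -> : u * u' - v * v' = u * (u' - v') + (u - v) * v'.
  by rewrite mulrBr mulrBl addrA subrK.
by apply: order_geD; [exact: order_geMr|exact: order_geMl].
Qed.

Lemma order_close_refl (d : nat) (u : laurent) : order_ge 0 u -> order_close d u u.
Proof. by move=> u0; split=> //; rewrite subrr; apply: order_ge0. Qed.

Lemma order_close_prod (d : nat) (I : Type) (s : seq I) (P : pred I) (f g : I -> laurent) :
  (forall i, P i -> order_close d (f i) (g i)) ->
  order_close d (\prod_(i <- s | P i) f i) (\prod_(i <- s | P i) g i).
Proof.
move=> dfg; apply: (big_ind2 (order_close d)) => //.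
  exact/order_close_refl/order_ge1.
by move=> *; apply: order_closeM.
Qed.

Lemma laurent_cvg_order (u : nat -> laurent) (a : {fps rat}) :
  (forall N, order_ge 0 (u N)) ->
  (forall d, exists N0, forall N, (N0 <= N)%N -> order_ge d (u N - a%:F)) ->
  laurent_cvg u a.
Proof.
move=> u0 ua; have /choice[v uv] : forall N, exists b : {fps rat}, u N = b%:F => [N|].
  by have [b ->] := u0 N; exists b; rewrite expr0 mul1r.
exists v => [N|k]; first by rewrite uv.
have [N0 Nk] := ua k.+1; exists N0 => N /Nk [b].
rewrite uv -tofracB => /eqP; rewrite tofrac_eq => /eqP /(congr1 (fun c : {fps rat} => c k)).
by rewrite coef_fpsXnM ltnSn coef_fpsB => /eqP; rewrite subr_eq0 => /eqP.
Qed.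

Lemma tofrac_invr (a : {fps rat}) : a \is a GRing.unit -> (a^-1)%:F = (a%:F)^-1.
Proof.
move=> ua; have a0 : a%:F != 0.
  by rewrite tofrac_eq0; apply: contraL ua => /eqP ->; rewrite unitr0.
by apply: (mulfI a0); rewrite divff // -tofracM divrr // tofrac1.
Qed.

Lemma unit_1subXn (e : nat) : (0 < e)%N -> 1 - fpsX rat ^+ e \is a GRing.unit.
Proof.
move=> e0; rewrite fps_unitE coef_fpsB coef_fpsXn coef_fps1 /=.
by case: e e0 => // e _; rewrite subr0 unitr1.
Qed.

Lemma tofrac_1subXn (e : nat) : (1 - fpsX rat ^+ e)%:F = 1 - lq ^+ e.
Proof. by rewrite tofracB tofrac1 tofracXn. Qed.

Lemma lq_neq0 : lq != 0.
Proof. by rewrite tofrac_eq0 -[fpsX rat]expr1 fpsXn_neq0. Qed.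

Lemma lqX_neq0 (d : nat) : lq ^+ d != 0.
Proof. by rewrite expf_neq0 // lq_neq0. Qed.

Lemma one_sub_lq_neq0 (e : nat) : (0 < e)%N -> 1 - lq ^+ e != 0.
Proof.
by move=> e0; rewrite subr_eq0 -(expr0 lq) (inj_eq fracX_expr_inj) eq_sym; case: e e0.
Qed.

Lemma order_ge_inv1sub (e : nat) : (0 < e)%N -> order_ge 0 (1 - lq ^+ e)^-1.
Proof.
by move=> e0; rewrite -tofrac_1subXn -tofrac_invr ?unit_1subXn //; apply: order_ge_fps0.
Qed.

Lemma ratio_expr_gt (F : fieldType) (x : F) (i y : nat) : x != 0 -> (y < i)%N ->
  x ^+ i / (x ^+ i - x ^+ y) = - (x ^+ (i - y) * (1 - x ^+ (i - y))^-1).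
Proof.
move=> x0 yi; have -> : x ^+ i = x ^+ y * x ^+ (i - y) by rewrite -exprD subnKC // ltnW.
rewrite -[in X in _ - X](mulr1 (x ^+ y)) -mulrBr -mulf_div divff ?mul1r ?expf_neq0 //.
by rewrite -opprB invrN mulrN.
Qed.

Lemma ratio_expr_lt (F : fieldType) (x : F) (i y : nat) : x != 0 -> (i < y)%N ->
  x ^+ i / (x ^+ i - x ^+ y) = (1 - x ^+ (y - i))^-1.
Proof.
move=> x0 iy; have -> : x ^+ y = x ^+ i * x ^+ (y - i) by rewrite -exprD subnKC // ltnW.
rewrite -[in X in X - _](mulr1 (x ^+ i)) -mulrBr invfM mulrA divff ?mul1r ?expf_neq0 //.
Qed.

(** The subtraction is truncated: for i > y the quotient is -q^(i-y) / (1 - q^(i-y)), and for i < y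
    it is 1 / (1 - q^(y-i)), of order 0. *)
Lemma order_ge_ratio (i y : nat) : i != y -> order_ge (i - y) (lq ^+ i / (lq ^+ i - lq ^+ y)).
Proof.
have [yi _|iy _|-> //] := ltngtP y i.
  rewrite ratio_expr_gt ?lq_neq0 //.
  by apply/order_geN/order_geMl; [exact: order_ge_lq|apply: order_ge_inv1sub; rewrite subn_gt0].
(* [ltnW iy] unfolds to [i - y == 0], which rewrites the order to 0. *)
rewrite ratio_expr_lt ?lq_neq0 // (eqP (ltnW iy)).
by apply: order_ge_inv1sub; rewrite subn_gt0.
Qed.

Lemma ratio_exprB (F : fieldType) (x : F) (i y M : nat) : (i <= M)%N ->
  (x ^+ i - x ^+ M) / (x ^+ i - x ^+ y) - x ^+ i / (x ^+ i - x ^+ y) =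
   - (x ^+ (M - i) * (x ^+ i / (x ^+ i - x ^+ y))).
Proof.
move=> iM; rewrite -mulrBl addrAC subrr add0r mulNr mulrA -exprD subnK //.
Qed.

Lemma order_ge_ratioB (i y M : nat) : i != y -> (i <= M)%N ->
  order_ge (M - i) ((lq ^+ i - lq ^+ M) / (lq ^+ i - lq ^+ y) - lq ^+ i / (lq ^+ i - lq ^+ y)).
Proof.
move=> iy iM.
rewrite ratio_exprB //.
apply/order_geN/order_geMl; first exact: order_ge_lq.
exact: order_ge_le (order_ge_ratio iy).
Qed.

Lemma order_ge_ratio0 (i y M : nat) : i != y -> (i <= M)%N ->
  order_ge 0 ((lq ^+ i - lq ^+ M) / (lq ^+ i - lq ^+ y)).
Proof.
move=> iy iM; rewrite -[X in order_ge _ X](subrK (lq ^+ i / (lq ^+ i - lq ^+ y))).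
apply: order_geD; first exact: order_ge_le (order_ge_ratioB iy iM).
exact: order_ge_le (order_ge_ratio iy).
Qed.

(** * Infinite products *)

Lemma fps_cvg_le (R : Type) (u : nat -> {fps R}) (a : {fps R}) (k : nat) :
  fps_cvg u a -> exists N0, forall N, (N0 <= N)%N -> forall i, (i <= k)%N -> u N i = a i.
Proof.
move=> ua; elim: k => [|k [N0 IH]].
  by have [N0 H] := ua 0%N; exists N0 => N /H e i; rewrite leqn0 => /eqP ->.
have [N1 H] := ua k.+1; exists (maxn N0 N1) => N; rewrite geq_max => /andP[N0N N1N] i.
by rewrite leq_eqVlt ltnS => /orP[/eqP ->|]; [exact: H|exact: IH].
Qed.

Lemma fps_cvgM (R : comNzRingType) (u v : nat -> {fps R}) (a b : {fps R}) :
  fps_cvg u a -> fps_cvg v b -> fps_cvg (fun N => u N * v N) (a * b).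
Proof.
move=> ua vb k; have [N0 H] := fps_cvg_le k ua; have [N1 K] := fps_cvg_le k vb.
exists (maxn N0 N1) => N; rewrite geq_max => /andP[N0N N1N].
rewrite !coef_fpsM; apply: eq_bigr => i _.
by rewrite H ?K ?leq_subr // -ltnS.
Qed.

Lemma fps_cvg_cst (R : Type) (a : {fps R}) : fps_cvg (fun=> a) a.
Proof. by move=> k; exists 0%N. Qed.

Lemma fps_cvg_prod (R : comNzRingType) (I : Type) (s : seq I) (u : I -> nat -> {fps R})
    (a : I -> {fps R}) :
  (forall i, fps_cvg (u i) (a i)) ->
  fps_cvg (fun N => \prod_(i <- s) u i N) (\prod_(i <- s) a i).
Proof.
move=> ua; elim: s => [|i s IH].
  by rewrite big_nil => k; exists 0%N => N _; rewrite big_nil.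
rewrite big_cons => k; have [N0 H] := fps_cvgM (ua i) IH k; exists N0 => N /H.
by rewrite big_cons.
Qed.

Lemma fps_cvg_subseq (R : Type) (u : nat -> {fps R}) (a : {fps R}) (f : nat -> nat) :
  (forall N, (N <= f N)%N) -> fps_cvg u a -> fps_cvg (u \o f) a.
Proof.
by move=> fN ua k; have [N0 H] := ua k; exists N0 => N N0N; apply: H; apply: leq_trans (fN N).
Qed.

Lemma qpochD (R : comNzRingType) (a p : R) (j N : nat) :
  qpoch a p (j + N) = qpoch a p j * qpoch (a * p ^+ j) p N.
Proof.
rewrite /qpoch (@big_cat_nat _ _ _ j) ?leq_addr //=; congr (_ * _).
rewrite -{1}[j]add0n big_addn addKn; apply: eq_bigr => i _.
by rewrite -mulrA -exprD addnC.
Qed.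

Lemma qpoch_inf_split (R : comNzRingType) (a p : {fps R}) (j : nat) : p 0%N = 0 ->
  qpoch_inf a p = qpoch a p j * qpoch_inf (a * p ^+ j) p.
Proof.
move=> p0; have aj := fps_cvg_subseq (leq_addl j) (qpoch_inf_cvg a p0).
apply: (fps_cvg_unique aj); have ->: qpoch a p \o addn j = fun N => qpoch a p j * qpoch (a * p ^+ j) p N.
  by apply: funext => N; rewrite /= qpochD.
by apply: fps_cvgM; [exact: fps_cvg_cst|exact: qpoch_inf_cvg].
Qed.

Local Notation q := (fpsX rat).

Lemma coef0_qX (K : nat) : (0 < K)%N -> (q ^+ K) 0%N = 0.
Proof. by move=> K0; rewrite coef_fpsXn; case: K K0. Qed.

Fact qX_inf_key : unit. Proof. exact: tt. Qed.

(* Locked, since conversion would otherwise unfold the limit. *)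
Definition qX_inf (K e : nat) : {fps rat} :=
  locked_with qX_inf_key (qpoch_inf (q ^+ e) (q ^+ K)).

Lemma qX_infE (K e : nat) : qX_inf K e = qpoch_inf (q ^+ e) (q ^+ K).
Proof. exact: locked_withE. Qed.

Lemma qX_inf_split (K e j : nat) : (0 < K)%N ->
  qX_inf K e = qpoch (q ^+ e) (q ^+ K) j * qX_inf K (e + K * j).
Proof. by move=> K0; rewrite !qX_infE (qpoch_inf_split _ j (coef0_qX K0)) -exprM -exprD. Qed.

Lemma coef_qX_inf (K e k : nat) : (0 < K)%N -> (k < e)%N -> qX_inf K e k = (k == 0%N)%:R.
Proof.
move=> K0 ke; rewrite qX_infE; have [N0 /(_ N0 (leqnn _)) <-] := qpoch_inf_cvg (q ^+ e) (coef0_qX K0) k.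
elim: N0 => [|N IHN]; first by rewrite /qpoch big_geq // coef_fps1.
have -> : qpoch (q ^+ e) (q ^+ K) N.+1 =
    qpoch (q ^+ e) (q ^+ K) N - q ^+ e * (qpoch (q ^+ e) (q ^+ K) N * (q ^+ K) ^+ N).
  by rewrite {1}/qpoch big_nat_recr //= mulrBr mulr1 mulrCA.
by rewrite coef_fpsB IHN coef_fpsXnM ke subr0.
Qed.

Lemma order_ge_qX_inf (K e : nat) : (0 < K)%N -> order_ge e ((qX_inf K e)%:F - 1).
Proof.
move=> K0; rewrite -tofrac1 -tofracB; apply: order_ge_fps => k ke.
by rewrite coef_fpsB coef_qX_inf // coef_fps1 subrr.
Qed.

Lemma unit_qX_inf (K e : nat) : (0 < K)%N -> (0 < e)%N -> qX_inf K e \is a GRing.unit.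
Proof. by move=> K0 e0; rewrite fps_unitE coef_qX_inf ?unitr1. Qed.

Lemma order_ge_qpoch_inf_sub (K e j : nat) : (0 < K)%N ->
  order_ge (e + K * j) ((qX_inf K e)%:F - (qpoch (q ^+ e) (q ^+ K) j)%:F).
Proof.
move=> K0; rewrite (qX_inf_split e j K0) tofracM -[X in _ - X]mulr1 -mulrBr.
by apply: order_geMr; [exact: order_ge_fps0|exact: order_ge_qX_inf].
Qed.

Lemma qpoch_q_residues (K N : nat) :
  qpoch q q (K * N) = \prod_(1 <= d < K.+1) qpoch (q ^+ d) (q ^+ K) N.
Proof.
elim: N => [|N IHN].
  rewrite muln0 [LHS]/qpoch big_geq //; apply/esym/big1 => d _.
  by rewrite /qpoch big_geq.
rewrite mulnS addnC qpochD IHN.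
rewrite [X in _ * X](_ : _ = \prod_(1 <= d < K.+1) (1 - q ^+ d * (q ^+ K) ^+ N)); last first.
  rewrite /qpoch big_add1 /=; apply: eq_bigr => d _.
  by rewrite -!exprM -!exprS -!exprD; congr (1 - q ^+ _); lia.
by rewrite -big_split; apply: eq_bigr => d _; rewrite /qpoch big_nat_recr.
Qed.

(** Sorting the exponents by residue modulo K gives an identity of finite products of length K N;
    then N tends to infinity. *)
Lemma qX_inf_residues (K : nat) : (0 < K)%N ->
  qX_inf 1 1 = \prod_(1 <= d < K.+1) qX_inf K d.
Proof.
move=> K0; rewrite qX_infE !expr1; under eq_bigr do rewrite qX_infE.
apply: (@fps_cvg_unique _ (qpoch q q \o muln K)).
  by apply: fps_cvg_subseq; [move=> N; exact: leq_pmull|exact: qpoch_inf_cvg].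
have -> : qpoch q q \o muln K = fun N => \prod_(1 <= d < K.+1) qpoch (q ^+ d) (q ^+ K) N.
  by apply: funext => N; exact: qpoch_q_residues.
by apply: fps_cvg_prod => d; apply: qpoch_inf_cvg; exact: coef0_qX.
Qed.

(** * Theta products and their duality *)

Lemma prod_differences (R : comPzSemiRingType) (n : nat) (f : nat -> R) :
  \prod_(1 <= j < n.+1) \prod_(1 <= i < j) f (j - i)%N =
  \prod_(1 <= d < n) f d ^+ (n - d).
Proof.
elim: n => [|n IHn]; first by rewrite !big_geq.
rewrite big_nat_recr //= IHn.
have -> : \prod_(1 <= i < n.+1) f (n.+1 - i)%N = \prod_(1 <= d < n.+1) f d.
  by rewrite big_nat_rev; apply: eq_big_nat => i /andP[i1 i2] /=; congr f; lia.
case: n {IHn} => [|n]; first by rewrite !big_geq ?mulr1.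
have -> : \prod_(1 <= d < n.+1) f d ^+ (n.+1 - d) = \prod_(1 <= d < n.+2) f d ^+ (n.+1 - d).
  by rewrite [RHS]big_nat_recr //= subnn expr0 mulr1.
rewrite -big_split /=; apply: eq_big_nat => d /andP[d1 d2].
by rewrite -exprSr; congr (_ ^+ _); lia.
Qed.

Lemma prod_differences_ord (R : comPzSemiRingType) (n : nat) (f : nat -> R) :
  \prod_(a < n) \prod_(c < n | (a < c)%N) f (c - a)%N =
  \prod_(1 <= j < n.+1) \prod_(1 <= i < j) f (j - i)%N.
Proof.
rewrite (exchange_big_dep xpredT) //= big_add1 big_mkord; apply: eq_bigr => c _.
rewrite big_add1 big_mkord (big_ord_widen n (fun i => f (c.+1 - i.+1)%N)) ?(ltnW (ltn_ord c)) //.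
Qed.

Definition theta_product (K n : nat) : {fps rat} :=
  \prod_(1 <= j < n.+1) \prod_(1 <= i < j) (qX_inf K (j - i) * qX_inf K (K - (j - i))).

(** The difference d occurs for n - d pairs, and K - d occurs as a difference for n - (K - d) pairs.
    Truncated subtraction makes both counts valid for all d. *)
Lemma theta_productE (K n : nat) : (n <= K)%N ->
  theta_product K n = \prod_(1 <= d < K) qX_inf K d ^+ (n - d + (d - (K - n))).
Proof.
move=> nK; rewrite /theta_product (prod_differences n (fun d => qX_inf K d * qX_inf K (K - d))).
transitivity (\prod_(1 <= d < K) (qX_inf K d * qX_inf K (K - d)) ^+ (n - d)).
  have [->|n0] := posnP n.
    by rewrite big_geq // big1 // => d _; rewrite sub0n expr0.
  rewrite [RHS](@big_cat_nat _ _ _ n) //= [X in _ * X]big_nat [X in _ * X]big1 ?mulr1 // => d /andP[nd _].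
  by rewrite (eqP nd) expr0.
under eq_bigr do rewrite exprMn; under [RHS]eq_bigr do rewrite exprD.
rewrite !big_split /=; congr (_ * _).
rewrite big_nat_rev; apply: eq_big_nat => d /andP[d1 d2] /=.
have -> : (1 + K - d.+1 = K - d)%N by lia.
by rewrite subKn ?(ltnW d2) //; congr (_ ^+ _); lia.
Qed.

Lemma theta_sideE (K n : nat) : (n <= K)%N ->
  theta_side K n = qX_inf K K ^+ n.-1 / qX_inf 1 1 ^+ n * theta_product K n.
Proof.
move=> nK.
have -> : theta_product K n =
    \prod_(1 <= j < n.+1) \prod_(1 <= i < j) theta (q ^+ (j - i)) (q ^+ K).
  rewrite /theta_product; apply: eq_big_nat => j /andP[j1 jn]; apply: eq_big_nat => i /andP[i1 ij].
  by rewrite theta_XnXn ?qX_infE //; lia.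
have -> : qX_inf 1 1 = qpoch_inf q q by rewrite qX_infE expr1.
by rewrite qX_infE.
Qed.

(** With [R] the product of the (q^d;q^K)_oo for d < K and [Q] = (q^K;q^K)_oo, one has (q;q)_oo = R
    Q. So each side is its theta product divided by a power of [R] and by [Q], and [XY] compares the
    theta products. *)
Lemma theta_side_duality (m n : nat) : (0 < m)%N -> (0 < n)%N ->
  theta_side (m + n) n = theta_side (m + n) m.
Proof.
move=> m0 n0; set K := (m + n)%N; have K0 : (0 < K)%N by rewrite /K; lia.
rewrite !theta_sideE ?leq_addl ?leq_addr // !theta_productE ?leq_addl ?leq_addr //.
have qK := qX_inf_residues K0; rewrite big_nat_recr //= in qK.
set Q := qX_inf K K in qK *; set R := \prod_(1 <= d < K) qX_inf K d in qK.
set X := \prod_(1 <= d < K) _; set Y := \prod_(1 <= d < K) _.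
(* The exponent of (q^d;q^K)_oo on either side is max(n, d) + max(m, d) - d. *)
have XY : X * R ^+ m = Y * R ^+ n.
  rewrite /X /Y /R -!prodrXl -!big_split /=; apply: eq_big_nat => d /andP[d1 d2].
  by rewrite -!exprD; congr (_ ^+ _); rewrite /K in d2 *; lia.
have UQ : Q \is a GRing.unit by exact: unit_qX_inf.
have UR : R \is a GRing.unit.
  by have : qX_inf 1 1 \is a GRing.unit; [exact: unit_qX_inf|rewrite qK unitrM => /andP[]].
rewrite qK !exprMn; case: (m) m0 XY => // m' _; case: (n) n0 => // n' _ XY /=.
have UQn k : Q ^+ k \is a GRing.unit by rewrite unitrX.
have URn k : R ^+ k \is a GRing.unit by rewrite unitrX.
have E k Z : Q ^+ k / (R ^+ k.+1 * Q ^+ k.+1) * Z = Z / R ^+ k.+1 / Q.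
  apply: (mulIr (URn k.+1)); apply: (mulIr (UQn k.+1)).
  rewrite [RHS](_ : _ = Z / R ^+ k.+1 * R ^+ k.+1 * (Q^-1 * Q) * Q ^+ k); last by rewrite [Q ^+ k.+1]exprS; ring.
  rewrite mulrVK // mulVr // mulr1.
  rewrite [LHS](_ : _ = Q ^+ k * Z * ((R ^+ k.+1 * Q ^+ k.+1)^-1 * (R ^+ k.+1 * Q ^+ k.+1))); last by ring.
  by rewrite mulVr ?unitrM ?URn ?UQn // mulr1 mulrC.
rewrite !E; congr (_ / Q); apply: (mulIr (URn n'.+1)); apply: (mulIr (URn m'.+1)).
by rewrite divrK // XY mulrAC divrK.
Qed.

(** The limit of the denominators [poch_fin] as all segment lengths grow. *)
Definition pochhammer_inf (n K : nat) : {fps rat} :=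
  \prod_(c < n) \prod_(a < n) qX_inf K (c + K - a).

(** For a < c, the factors of (a, c) and (c, a) have first exponents K - (c - a) and K + (c - a);
    the factor 1 - q^(c-a) lowers the latter to c - a, which completes a theta function. *)
Lemma pochhammer_infE (n K : nat) : (0 < n)%N -> (n <= K)%N ->
  (\prod_(a < n) \prod_(c < n | (a < c)%N) (1 - q ^+ (c - a))) * pochhammer_inf n K =
  qX_inf K K ^+ n * theta_product K n.
Proof.
move=> n0 nK; have K0 : (0 < K)%N by lia.
have -> : pochhammer_inf n K = qX_inf K K ^+ n *
    \prod_(a < n) \prod_(c < n | (a < c)%N) (qX_inf K (K - (c - a)) * qX_inf K (K + (c - a))).
  rewrite /pochhammer_inf (prod_diag_pairs (fun c a : 'I_n => qX_inf K (c + K - a))).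
  have -> : \prod_(a < n) qX_inf K (a + K - a) = qX_inf K K ^+ n.
    under eq_bigr do rewrite addKn.
    by rewrite prodr_const card_ord.
  apply: congr1; apply: eq_bigr => a _; apply: eq_bigr => c ac.
  have -> : (a + K - c = K - (c - a))%N by have := ltn_ord c; lia.
  by have -> : (c + K - a = K + (c - a))%N by lia.
rewrite mulrCA; apply: congr1; rewrite /theta_product.
rewrite -(prod_differences_ord n (fun d => qX_inf K d * qX_inf K (K - d))).
rewrite -big_split; apply: eq_bigr => a _; rewrite -big_split; apply: eq_bigr => c ac /=.
rewrite (qX_inf_split (c - a) 1 K0) /qpoch big_nat1 expr0 mulr1 muln1 addnC.
by rewrite mulrA [LHS]mulrAC.
Qed.

(** For K = n the exponents in [theta_productE] are all (n - d) + d = n, so every residue class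
    occurs n times. *)
Lemma pochhammer_inf_diag (n : nat) : (0 < n)%N ->
  (\prod_(a < n) \prod_(c < n | (a < c)%N) (1 - q ^+ (c - a))) * pochhammer_inf n n = qX_inf 1 1 ^+ n.
Proof.
move=> n0; rewrite pochhammer_infE // theta_productE // (qX_inf_residues n0).
rewrite big_nat_recr //= exprMn mulrC; congr (_ * _); rewrite -prodrXl.
by apply: eq_big_nat => d /andP[d1 d2]; congr (_ ^+ _); lia.
Qed.

Lemma unit_pochhammer_inf (n K : nat) : (n <= K)%N -> pochhammer_inf n K \is a GRing.unit.
Proof.
move=> nK; rewrite /pochhammer_inf; apply: (big_ind (fun x => x \is a GRing.unit)) => [|x y|c _].
- exact: unitr1.
- by rewrite unitrM => -> ->.
apply: (big_ind (fun x => x \is a GRing.unit)) => [|x y|a _].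
- exact: unitr1.
- by rewrite unitrM => -> ->.
by have := ltn_ord a => an; apply: unit_qX_inf; lia.
Qed.

(** The theta quotient is the ratio of the limiting denominators for K and for n, up to
    (q^K;q^K)_oo; the finite product [V] common to both cancels. *)
Lemma theta_side_pochhammer (n K : nat) : (0 < n)%N -> (n <= K)%N ->
  theta_side K n * (qX_inf K K * pochhammer_inf n n) = pochhammer_inf n K.
Proof.
move=> n0 nK; set V := \prod_(a < n) \prod_(c < n | (a < c)%N) (1 - q ^+ (c - a)).
have V0 : V != 0.
  apply/prodf_neq0 => a _; apply/prodf_neq0 => c ac.
  by apply: contraL (unit_1subXn (_ : (0 < c - a)%N)) => [/eqP->|]; rewrite ?unitr0 ?subn_gt0.
apply: (mulfI V0); rewrite [RHS]pochhammer_infE // theta_sideE //.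
rewrite [LHS](_ : _ = qX_inf K K ^+ n.-1 / qX_inf 1 1 ^+ n * theta_product K n * qX_inf K K *
   (V * pochhammer_inf n n)); last by ring.
rewrite pochhammer_inf_diag //.
rewrite [LHS](_ : _ = qX_inf K K ^+ n.-1 * qX_inf K K * theta_product K n *
   ((qX_inf 1 1 ^+ n)^-1 * qX_inf 1 1 ^+ n)); last by ring.
by rewrite mulVr ?unitrX ?unit_qX_inf // mulr1 -exprSr prednK.
Qed.

(** * Convergence *)

Lemma lqX_eq (i j : nat) : (lq ^+ i == lq ^+ j) = (i == j).
Proof. exact: (inj_eq fracX_expr_inj). Qed.

(** The limit for large N of the unweighted segment term: the power of q at the end of each class
    tends to 0. *)
Definition seg_term (n K : nat) (k : 'I_n -> nat) : laurent :=
  \prod_(a < n) \prod_(s < k a) \prod_(b < n)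
      (lq ^+ (a + K * s) / (lq ^+ (a + K * s) - lq ^+ (b + K * k b))).

Definition poch_fin (n K : nat) (k : 'I_n -> nat) : {fps rat} :=
  \prod_(c < n) \prod_(a < n) qpoch (q ^+ (c + K - a)) (q ^+ K) (k c).

Lemma tofrac_prod (R : idomainType) (I : Type) (s : seq I) (P : pred I) (f : I -> R) :
  (\prod_(i <- s | P i) f i)%:F = \prod_(i <- s | P i) (f i)%:F.
Proof. exact: (big_morph _ (@tofracM R) (tofrac1 R)). Qed.

Lemma tofrac_qpoch (e K j : nat) :
  (qpoch (q ^+ e) (q ^+ K) j)%:F = \prod_(s < j) (1 - lq ^+ (e + K * s)).
Proof.
rewrite /qpoch big_mkord tofrac_prod; apply: eq_bigr => s _.
by rewrite -exprM -exprD tofrac_1subXn.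
Qed.

Lemma tofrac_poch_fin (n K : nat) (k : 'I_n -> nat) : (n <= K)%N ->
  (poch_fin K k)%:F = \prod_(c < n) \prod_(s < k c) \prod_(a < n) (1 - lq ^+ (c + K * s.+1 - a)).
Proof.
move=> nK; rewrite /poch_fin tofrac_prod; apply: eq_bigr => c _.
rewrite tofrac_prod [RHS]exchange_big; apply: eq_bigr => a _.
rewrite tofrac_qpoch; apply: eq_bigr => s _.
have -> // : (c + K - a + K * s = c + K * s.+1 - a)%N.
by have := ltn_ord a; rewrite mulnS; lia.
Qed.

Lemma order_ge_seg_term0 (n K : nat) (k : 'I_n -> nat) : (n <= K)%N -> order_ge 0 (seg_term K k).
Proof.
move=> nK; apply: order_ge_prod0 => a _; apply: order_ge_prod0 => s _; apply: order_ge_prod0 => b _.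
exact/(order_ge_le (leq0n _))/order_ge_ratio/affine_index_neq.
Qed.

Lemma order_ge_seg_term (n K d r : nat) (k : 'I_n -> nat) (b : 'I_n) :
  (n <= K)%N -> (b + K * k b < d)%N -> (\sum_(a < n) k a = r)%N ->
  order_ge (r - n * d) (seg_term K k).
Proof.
move=> nK yd kr; have K0 : (0 < K)%N by have := ltn_ord b; lia.
apply: order_ge_le (sum_index_lower K0 yd kr) _.
apply: order_ge_prod => a _; apply: order_ge_prod => s _; apply: order_ge_prod => c _.
exact/order_ge_ratio/affine_index_neq.
Qed.

(** If some end b + K k_b is below d, the term itself has order at least r - n d >= d. Otherwise
    every k_c is large enough for [poch_fin] to agree with its limit modulo q^d. *)
Lemma order_ge_seg_term_error (n K d r : nat) (k : 'I_n -> nat) :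
  (0 < n)%N -> (n <= K)%N -> (n.+1 * d <= r)%N -> (\sum_(a < n) k a = r)%N ->
  order_ge d (seg_term K k * ((pochhammer_inf n K)%:F - (poch_fin K k)%:F)).
Proof.
move=> n0 nK dr kr; have K0 : (0 < K)%N by lia.
have [/existsP[b yd]|/existsPn ny] := boolP [exists b : 'I_n, (b + K * k b < d)%N].
  apply: order_geMl; last by rewrite -tofracB; apply: order_ge_fps0.
  by apply: order_ge_le (order_ge_seg_term nK yd kr); rewrite mulSn in dr; lia.
apply: order_geMr; first exact: order_ge_seg_term0.
rewrite /pochhammer_inf /poch_fin !tofrac_prod.
suff [] : order_close d (\prod_(c < n) (\prod_(a < n) qX_inf K (c + K - a))%:F)
   (\prod_(c < n) (\prod_(a < n) qpoch (q ^+ (c + K - a)) (q ^+ K) (k c))%:F) by [].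
apply: order_close_prod => c _; rewrite !tofrac_prod; apply: order_close_prod => a _.
split; try exact: order_ge_fps0.
apply: order_ge_le (order_ge_qpoch_inf_sub _ _ K0).
by have := ny c; have := ltn_ord a; lia.
Qed.

(** The bound on [N] puts the end of every class at least d above every index of a segment, so
    dropping it from the numerators changes nothing modulo q^d. *)
Lemma order_close_fin_term (n K N r d : nat) (k : 'I_n -> nat) (G : 'I_n -> nat -> laurent) :
  (n <= K)%N -> (forall a s, order_ge 0 (G a s)) -> (forall a, k a <= r)%N ->
  (n * (r + d).+1 <= N)%N ->
  order_close d
    (\prod_(a < n) \prod_(s < k a)
       (G a s * segment_ratio (fun a s => lq ^+ (a + K * s)) (class_size n N) k a s))
    ((\prod_(a < n) \prod_(s < k a) G a s) * seg_term K k).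
Proof.
move=> nK G0 kr rN; rewrite -big_split; apply: order_close_prod => a _.
have n0 : (0 < n)%N by have := ltn_ord a; lia.
rewrite -big_split; apply: order_close_prod => s _; apply: order_closeM.
  exact: order_close_refl.
apply: order_close_prod => b _.
have ne := affine_index_neq b nK (ltn_ord s).
have idx : (a + K * s + d <= b + K * class_size n N b)%N.
  have cs : ((r + d).+1 <= class_size n N b)%N.
    apply: leq_trans (leq_addr _ _); rewrite leq_divRL //; lia.
  have := kr a; have := ltn_ord s; have := ltn_ord a; nia.
split.
- by apply: order_ge_ratio0 => //; lia.
- exact: order_ge_le (order_ge_ratio ne).
- apply: order_ge_le (order_ge_ratioB ne _); lia.
Qed.

Lemma lqX_step (n K : nat) (a : 'I_n) (s : nat) :
  lq ^+ K * lq ^+ (a + K * s) = lq ^+ (a + K * s.+1).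
Proof. by rewrite -exprD; have -> : (K + (a + K * s) = a + K * s.+1)%N by rewrite mulnS; lia. Qed.

Lemma lqX_affine_inj (n K : nat) (a b : 'I_n) (s u : nat) : (n <= K)%N ->
  lq ^+ (a + K * s) = lq ^+ (b + K * u) -> a = b /\ s = u.
Proof.
move=> nK /fracX_expr_inj /affine_index_inj[||/val_inj -> ->] //; exact: leq_trans nK.
Qed.

Lemma qpoch_lq_neq0 (K k : nat) : (0 < K)%N -> qpoch (lq ^+ K) (lq ^+ K) k != 0.
Proof.
move=> K0; rewrite /qpoch big_mkord; apply/prodf_neq0 => j _.
by rewrite -exprM -exprD one_sub_lq_neq0 // addn_gt0 K0.
Qed.

Lemma points_inj (n K N : nat) (n0 : (0 < n)%N) : (n <= K)%N ->
  injective (fun i : 'I_N => lq ^+ (residue n0 i + K * (i %/ n))).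
Proof.
move=> nK i j /(lqX_affine_inj nK) [/(congr1 val) /= ab su]; apply: val_inj.
by rewrite /= (divn_eq i n) ab su -divn_eq.
Qed.

Lemma quotient_sub (F : fieldType) (u v w Q : F) : v != 0 -> w != 0 -> Q != 0 ->
  u / (v * w) - Q^-1 = ((v * (Q - w) + (Q - v) * Q) - (Q - u) * Q) * (v^-1 * w^-1 * Q^-1).
Proof. by move=> v0 w0 Q0; field; rewrite v0 w0 Q0. Qed.

(** At finite N the unweighted sum at the points q^(a + K s) with t = q^K is a q-binomial
    coefficient by [sum_subsets_hl_ratio]. Modulo q^d all three of its Pochhammer symbols equal
    (q^K;q^K)_oo, two of them in the denominator. *)
Lemma sum_seg_term_cvg (n K d r : nat) : (0 < n)%N -> (n <= K)%N -> (d <= r)%N ->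
  order_ge d (\sum_(k : {ffun 'I_n -> 'I_r.+1} | (\sum_(b < n) k b == r)%N)
     seg_term K (fun b => k b) - ((qX_inf K K)%:F)^-1).
Proof.
move=> n0 nK dr; have K0 : (0 < K)%N by lia.
(* The first summand serves [order_close_fin_term]; the second ensures d <= N - r. *)
pose N := (n * (r + d).+1 + (r + d))%N.
pose H := qpoch (lq ^+ K) (lq ^+ K) N /
  (qpoch (lq ^+ K) (lq ^+ K) r * qpoch (lq ^+ K) (lq ^+ K) (N - r)).
have HE : H = \sum_(k : {ffun 'I_n -> 'I_r.+1} | (\sum_(b < n) k b == r)%N)
    \prod_(a < n) \prod_(s < k a)
       (1 * segment_ratio (fun a s => lq ^+ (a + K * s)) (class_size n N) (fun b => k b) a s).
  rewrite -(sum_hl_subset_term_segments n0 N r (fun _ _ => 1) (@lqX_step n K)); last first.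
    by move=> a b s u; exact: lqX_affine_inj.
  rewrite /H -(sum_subsets_hl_ratio (@points_inj n K N n0 nK) (lqX_neq0 K)); last 2 first.
  - by move=> k; exact: qpoch_lq_neq0.
  - by rewrite /N; lia.
  by apply: eq_bigr => I _; rewrite /hl_subset_term [X in _ = X * _]big1 // mul1r.
rewrite -[X in order_ge _ X](subrKA H); apply: order_geD.
  rewrite -[X in order_ge _ X]opprB HE -sumrB; apply/order_geN/order_ge_sum => k _.
  have G0 : forall (a : 'I_n) (s : nat), order_ge 0 1 by move=> *; exact: order_ge1.
  have kr (a : 'I_n) : (k a <= r)%N by rewrite -ltnS.
  have rN : (n * (r + d).+1 <= N)%N by rewrite /N leq_addr.
  have [_ _] := order_close_fin_term nK G0 kr rN.
  by rewrite [X in X * _]big1 ?mul1r // => a _; rewrite big1.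
have qpochE j : qpoch (lq ^+ K) (lq ^+ K) j = (qpoch (q ^+ K) (q ^+ K) j)%:F.
  rewrite tofrac_qpoch /qpoch big_mkord; apply: eq_bigr => s _.
  by rewrite -exprM -exprD.
have close j : (d <= j)%N -> order_ge d ((qX_inf K K)%:F - qpoch (lq ^+ K) (lq ^+ K) j).
  move=> dj; rewrite qpochE; apply: order_ge_le (order_ge_qpoch_inf_sub _ _ K0); nia.
have inv j : order_ge 0 (qpoch (lq ^+ K) (lq ^+ K) j)^-1.
  rewrite /qpoch big_mkord -prodfV; apply: order_ge_prod0 => s _.
  by rewrite -exprM -exprD; apply: order_ge_inv1sub; rewrite addn_gt0 K0.
have UQ := unit_qX_inf K0 K0.
have Qinv : order_ge 0 ((qX_inf K K)%:F)^-1 by rewrite -tofrac_invr //; apply: order_ge_fps0.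
have Q0 : (qX_inf K K)%:F != 0.
  by rewrite tofrac_eq0; apply: contraL UQ => /eqP->; rewrite unitr0.
have dN : (d <= N)%N by rewrite /N; lia.
have dNr : (d <= N - r)%N by rewrite /N; lia.
move: (qpoch_lq_neq0 r K0) (qpoch_lq_neq0 (N - r) K0) (inv r) (inv (N - r)%N)
  (close N dN) (close r dr) (close (N - r)%N dNr) Qinv Q0; rewrite /H !qpochE.
move: (order_ge_fps0 (qpoch (q ^+ K) (q ^+ K) r)) (order_ge_fps0 (qX_inf K K)).
set u := (qpoch (q ^+ K) (q ^+ K) N)%:F; set v := (qpoch (q ^+ K) (q ^+ K) r)%:F.
set w := (qpoch (q ^+ K) (q ^+ K) (N - r))%:F; set Q := (qX_inf K K)%:F.
move=> v0 Q0 vn wn vi wi cu cv cw Qi Qn.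
rewrite (quotient_sub u vn wn Qn).
apply: order_geMl; last by do !apply: order_geMl.
apply: order_geB; [apply: order_geD|].
- exact: order_geMr.
- exact: order_geMl.
- exact: order_geMl.
Qed.

(** * The principal specialization and its limit *)

Lemma hall_littlewood_principal (n r m N : nat) : (0 < n)%N -> (0 < r)%N -> (0 < m)%N ->
  hall_littlewood (fun i : 'I_N => lq ^+ i) (lq ^+ n) (nseq r m) =
  \sum_(k : {ffun 'I_n -> 'I_r.+1} | (\sum_(b < n) k b == r)%N)
    \prod_(a < n) \prod_(s < k a)
       (lq ^+ (m * (a + n * s)) *
        segment_ratio (fun a s => lq ^+ (a + n * s)) (class_size n N) (fun b => k b) a s).
Proof.
move=> n0 r0 m0.
have xI : injective (fun i : 'I_N => lq ^+ i) by move=> i j /fracX_expr_inj /val_inj.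
rewrite (hall_littlewood_nseq xI (lqX_neq0 n) (fun k => qpoch_lq_neq0 k n0) r0 m0).
rewrite -(sum_hl_subset_term_segments n0 N r (fun a s => lq ^+ (m * (a + n * s))) (@lqX_step n n)); last first.
  by move=> a b s u; exact: lqX_affine_inj.
apply: eq_bigr => I _; have iE (i : 'I_N) : (residue n0 i + n * (i %/ n))%N = i.
  by rewrite /= [in RHS](divn_eq i n) addnC mulnC.
congr (hl_subset_term _ _ _ _); apply: funext => i; rewrite iE //.
by rewrite mulnC exprM.
Qed.

(** A term whose segments do not fit is zero. In the others each class ends at or beyond N, hence
    above all indices, and [order_ge_ratio0] applies. *)
Lemma order_ge_principal_term (n r m N : nat) (k : 'I_n -> nat) :
  order_ge 0 (\prod_(a < n) \prod_(s < k a)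
       (lq ^+ (m * (a + n * s)) *
        segment_ratio (fun a s => lq ^+ (a + n * s)) (class_size n N) k a s)).
Proof.
have [fit|/forallPn[a0]] := boolP [forall a, k a <= class_size n N a]%N; last first.
  rewrite -ltnNge => ka; rewrite (bigD1 a0) //= (bigD1 (Ordinal ka)) //= /segment_ratio.
  rewrite [X in _ * X * _ * _](bigD1 a0) //= subrr !mul0r mulr0 !mul0r; exact: order_ge0.
apply: order_ge_prod0 => a _; apply: order_ge_prod0 => s _; apply: order_geMl.
  exact: order_ge_le (order_ge_lq _).
apply: order_ge_prod0 => b _; apply: order_ge_ratio0; first exact: affine_index_neq (leqnn n) _.
have sN : (a + n * s < N)%N.
  by rewrite -ltn_class_size //; apply: leq_trans (forallP fit a).
apply: leq_trans (ltnW sN) _; rewrite leqNgt -ltn_class_size // ltnn //.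
Qed.

(** The value of P_(m^r)(1, q, q^2, ...; q^n), as [hl_principal_sum] shows. *)
Definition principal_sum (n m r : nat) : laurent :=
  \sum_(k : {ffun 'I_n -> 'I_r.+1} | (\sum_(b < n) k b == r)%N)
    lq ^+ (m * index_sum n (fun b => k b)) * seg_term n (fun b => k b).

Lemma order_ge_principal_sum (n m r : nat) : (0 < n)%N ->
  order_ge 0 (lq ^- (m * 'C(r, 2)) * principal_sum n m r).
Proof.
move=> n0; rewrite /principal_sum big_distrr /=; apply: order_ge_sum => k /eqP kr.
rewrite mulrA; apply: order_geMl; last exact: order_ge_seg_term0.
have le : (m * 'C(r, 2) <= m * index_sum n (fun b => k b))%N.
  by rewrite leq_mul2l -[X in 'C(X, 2)]kr bin2_le_index_sum ?orbT.
rewrite -(subnKC le) exprD mulKf ?lqX_neq0 //.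
exact: order_ge_le (order_ge_lq _).
Qed.

Lemma hl_principal_sum (n m r : nat) (P : {fps rat}) :
  (0 < n)%N -> (0 < r)%N -> (0 < m)%N -> P%:F = principal_sum n m r ->
  hl_principal n (nseq r m) P.
Proof.
move=> n0 r0 m0 PE; apply: laurent_cvg_order => [N|d].
  rewrite hall_littlewood_principal //; apply: order_ge_sum => k _.
  exact: order_ge_principal_term.
exists (n * (r + d).+1)%N => N rN.
rewrite hall_littlewood_principal // PE -sumrB; apply: order_ge_sum => k _.
have G0 (a : 'I_n) (s : nat) : order_ge 0 (lq ^+ (m * (a + n * s))).
  exact: order_ge_le (order_ge_lq _).
have kr (a : 'I_n) : (k a <= r)%N by rewrite -ltnS.
have [_ _] := order_close_fin_term (leqnn n) G0 kr rN.
have -> // : \prod_(a < n) \prod_(s < k a) lq ^+ (m * (a + n * s)) =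
  lq ^+ (m * index_sum n (fun b => k b)).
by rewrite mulnC exprM /index_sum -!prodrXr -prodrXl; apply: eq_bigr => a _;
   rewrite -prodrXr -prodrXl; apply: eq_bigr => s _; rewrite -exprM mulnC.
Qed.

(** The factor in [seg_prod_vdm] that depends on [k] only through its sum r, so that it can be taken
    out of the sum. *)
Definition segment_unit (n K r : nat) : laurent :=
  (-1) ^+ (n.-1 * r) * lq ^+ (K * 'C(r, 2) + 'C(n, 2) * r) *
   \prod_(a < n) \prod_(b < n | (a < b)%N) (lq ^+ a - lq ^+ b).

Lemma segment_unit_neq0 (n K r : nat) : segment_unit n K r != 0.
Proof.
rewrite !mulf_neq0 ?lqX_neq0 ?signr_eq0 //.
apply/prodf_neq0 => a _; apply/prodf_neq0 => b ab.
by rewrite subr_eq0 lqX_eq ltn_eqF.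
Qed.

Lemma seg_term_unit (n K r : nat) (k : 'I_n -> nat) : (n <= K)%N -> (\sum_(a < n) k a = r)%N ->
  seg_term K k * (poch_fin K k)%:F * segment_unit n K r =
  lq ^+ (n * index_sum K k) * vdm_at lq K k.
Proof.
move=> nK kr; rewrite tofrac_poch_fin // /segment_unit -kr.
apply: seg_prod_vdm => //; first exact: lq_neq0.
by move=> a b s sk; rewrite lqX_eq affine_index_neq.
Qed.

Lemma shift_unit (F : fieldType) (u v t p e x : F) : u != 0 ->
  t * p * e = x -> u^-1 * (v * t) * p * (u * e) = v * x.
Proof. by move=> u0 <-; field. Qed.

Lemma eq_sum_mulI (R : idomainType) (I : Type) (s : seq I) (P : pred I) (f g : I -> R) (e : R) :
  e != 0 -> \sum_(i <- s | P i) f i * e = \sum_(i <- s | P i) g i * e ->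
  \sum_(i <- s | P i) f i = \sum_(i <- s | P i) g i.
Proof. by move=> e0 E; apply: (mulIf e0); rewrite !big_distrl. Qed.

(** After multiplication by [segment_unit n (m + n) r], both sides are sums of Vandermonde terms,
    which [sum_vdm_at_swap] exchanges. The power q^(m C(r, 2)) is exactly the ratio of the units for
    m + n and for n. *)
Lemma principal_sum_exchange (n m r : nat) :
  \sum_(k : {ffun 'I_n -> 'I_r.+1} | (\sum_(b < n) k b == r)%N)
    lq ^- (m * 'C(r, 2)) * (lq ^+ (m * index_sum n (fun b => k b)) * seg_term n (fun b => k b)) *
      (poch_fin n (fun b => k b))%:F =
  \sum_(k : {ffun 'I_n -> 'I_r.+1} | (\sum_(b < n) k b == r)%N)
    seg_term (m + n) (fun b => k b) * (poch_fin (m + n) (fun b => k b))%:F.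
Proof.
apply: (eq_sum_mulI (segment_unit_neq0 n (m + n) r)).
transitivity (\sum_(k : {ffun 'I_n -> 'I_r.+1} | (\sum_(b < n) k b == r)%N)
    lq ^+ ((m + n) * index_sum n (fun b => k b)) * vdm_at lq n (fun b => k b)).
  apply: eq_bigr => k /eqP kr.
  have -> : segment_unit n (m + n) r = lq ^+ (m * 'C(r, 2)) * segment_unit n n r.
    by rewrite /segment_unit mulnDl -addnA exprD !mulrA [_ * lq ^+ (m * _)]mulrC.
  rewrite (shift_unit _ (lqX_neq0 _) (seg_term_unit (leqnn n) kr)) mulnDl exprD mulrA //.
rewrite sum_vdm_at_swap; apply: eq_bigr => k /eqP kr.
by rewrite seg_term_unit ?leq_addl.
Qed.

(** Splits the error g - th into three: replacing finite denominators by [p] in g, replacing them by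
    [pb] in s, and replacing u by its limit 1 / Q. *)
Lemma theta_combination (F : fieldType) (g p s u pb Q th : F) : p != 0 -> Q != 0 ->
  th * (Q * p) = pb -> g - th = (((g * p - s) - (u * pb - s)) + (u - Q^-1) * pb) * p^-1.
Proof. by move=> p0 Q0 <-; field; rewrite p0 Q0. Qed.

Lemma mulr_regroup (R : pzRingType) (c w t d : R) : c * (w * t) * d = (c * w) * (t * d).
Proof. by rewrite !mulrA. Qed.

Lemma principal_sum_cvg (n m r d : nat) : (0 < n)%N -> (n.+1 * d <= r)%N ->
  order_ge d (lq ^- (m * 'C(r, 2)) * principal_sum n m r - (theta_side (m + n) n)%:F).
Proof.
move=> n0 dr; set K := (m + n)%N; have nK : (n <= K)%N by rewrite /K leq_addl.
have K0 : (0 < K)%N by lia.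
have UQ := unit_qX_inf K0 K0; have Up := unit_pochhammer_inf (leqnn n).
have unit_neq0 (a : {fps rat}) : a \is a GRing.unit -> a%:F != 0.
  by move=> Ua; rewrite tofrac_eq0; apply: contraL Ua => /eqP->; rewrite unitr0.
have th : (theta_side K n)%:F * ((qX_inf K K)%:F * (pochhammer_inf n n)%:F) = (pochhammer_inf n K)%:F.
  by rewrite -!tofracM theta_side_pochhammer.
pose s := \sum_(k : {ffun 'I_n -> 'I_r.+1} | (\sum_(b < n) k b == r)%N)
    seg_term K (fun b => k b) * (poch_fin K (fun b => k b))%:F.
pose u := \sum_(k : {ffun 'I_n -> 'I_r.+1} | (\sum_(b < n) k b == r)%N) seg_term K (fun b => k b).
rewrite (theta_combination _ s u (unit_neq0 _ Up) (unit_neq0 _ UQ) th).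
apply: order_geMl; last by rewrite -tofrac_invr //; apply: order_ge_fps0.
apply: order_geD; first apply: order_geB.
- rewrite /s -principal_sum_exchange /principal_sum big_distrr big_distrl /= -sumrB.
  apply: order_ge_sum => k /eqP kr; rewrite -mulrBr mulr_regroup; apply: order_geMr.
    have le : (m * 'C(r, 2) <= m * index_sum n (fun b => k b))%N.
      by rewrite leq_mul2l -[X in 'C(X, 2)]kr bin2_le_index_sum ?orbT.
    rewrite -(subnKC le) exprD mulKf ?lqX_neq0 //.
    exact: order_ge_le (order_ge_lq _).
  exact: (order_ge_seg_term_error (r := r)).
- rewrite /s /u big_distrl /= -sumrB; apply: order_ge_sum => k /eqP kr.
  by rewrite -mulrBr; apply: (order_ge_seg_term_error (r := r)).
- apply: order_geMl; last exact: order_ge_fps0.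
  by apply: sum_seg_term_cvg => //; rewrite mulSn in dr; lia.
Qed.

Theorem theorem1p5 (m n : nat) (hm : (0 < m)%N) (hn : (0 < n)%N) :
  let kappa := (m + n)%N in
  exists P : nat -> {fps rat},
    [/\ forall r, (0 < r)%N -> hl_principal n (nseq r m) (P r),
        laurent_cvg (fun r => lq ^- (m * 'C(r, 2)) * (P r)%:F)
                    (theta_side kappa n)
      & theta_side kappa n = theta_side kappa m].
Proof.
move=> kappa.
(* Each term has order at least 0, so the Laurent series [principal_sum n m r] is a power series,
   taken as [P r]. *)
have /choice[P PE] : forall r, exists P : {fps rat}, P%:F = principal_sum n m r => [r|].
  have [b bE] : order_ge 0 (principal_sum n m r).
    apply: order_ge_sum => k _; apply: order_geMl; last exact: order_ge_seg_term0.
    exact: order_ge_le (order_ge_lq _).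
  by exists b; rewrite bE expr0 mul1r.
exists P; split; last exact: theta_side_duality.
  by move=> r r0; apply: hl_principal_sum.
apply: laurent_cvg_order => [r|d]; first by rewrite PE; apply: order_ge_principal_sum.
by exists (n.+1 * d)%N => r rd; rewrite PE; apply: principal_sum_cvg.
Qed.
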